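(* For every positive integer $k$, \[ \mu(1+x+y_1+z_1,\ \ldots,\ 1+x+y_k+z_k) \;=\; \frac{1}{\pi^{k+1}}\int_0^\pi \left(\theta\log\left(2\sin\frac{\theta}{2}\right) + \mathrm{Cl}_2(\theta)\right)^k\,\mathrm{d}\theta, \] where the left-hand side is the multiple Mahler measure of the $k$ polynomials $1+x+y_j+z_j$ in the $2k+1$ variables $x,y_1,\dots,y_k,z_1,\dots,z_k$.
   Context: For functions $P_1,\ldots,P_k$ of $n$ variables, the multiple Mahler measure is \[ \mu(P_1,\ldots,P_k) := \int_0^1\cdots\int_0^1 \prod_{j=1}^k \log\left|P_j\left(e^{2\pi i t_1},\ldots,e^{2\pi i t_n}\right)\right|\,\mathrm{d}t_1\cdots\mathrm{d}t_n . \] The Clausen function is $\mathrm{Cl}_2(\theta) := \sum_{n=1}^\infty \frac{\sin(n\theta)}{n^2}$. *)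

(* Defs.v *)
From mathcomp Require Import all_boot all_order all_algebra.
From mathcomp Require Import all_classical all_reals all_analysis.
From mathcomp Require Import complex.
Set Implicit Arguments. Unset Strict Implicit. Unset Printing Implicit Defensive.
Import Order.TTheory GRing.Theory Num.Theory numFieldNormedType.Exports.
Local Open Scope classical_set_scope.
Local Open Scope ring_scope.

Section Defs.
Variable R : realType.

Definition expi2pi (t : R) : R[i] := (cos (2 * pi * t) +i* sin (2 * pi * t))%C.

(* Iterated Lebesgue integral over [0,1]^n of F : (nat -> R) -> R, where
   the integration variables are t_0, ..., t_(n-1) (other coordinates set to 0).
   iter_int n.+1 F = int_0^1 ( iter_int n (F with t_n := t) ) dt. *)
Fixpoint iter_int (n : nat) (F : (nat -> R) -> R) : R :=
  match n with
  | 0 => F (fun _ => 0)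
  | n'.+1 => Rintegral lebesgue_measure `[0, 1]
       (fun t => iter_int n' (fun v => F (fun i => if i == n' then t else v i)))
  end.

Definition multi_mahler (n : nat) (Ps : seq ((nat -> R[i]) -> R[i])) : R :=
  iter_int n (fun t => \prod_(P <- Ps) ln (Normc.normc (P (fun j => expi2pi (t j))))).

Definition Cl2 (theta : R) : R :=
  limn (series (fun n : nat => sin (n.+1%:R * theta) / (n.+1%:R ^+ 2))).

(* The polynomial 1 + x + y_j + z_j in variables x = v 0, y_j = v j,
   z_j = v (k + j), for j = 1..k. *)
Definition P1xyz (k j : nat) (v : nat -> R[i]) : R[i] :=
  1 + v 0%N + v j + v (k + j)%N.

End Defs.

(* Main.v *)
(** Integrating the [y_j] first, Jensen's formula turns each
    [log |1 + x + y_j + z_j|] into [log+ |1 + x + z_j|]; the remaining integrals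
    over the [z_j] are then equal, so the measure is the mean over [x] of the
    [k]-th power of the mean over [z] of [log+ |1 + x + z|].  With
    [|1 + x| = r = 2 sin (theta / 2)] this last mean is [W / pi], where [W] is the
    integral of [log+ |r + e^{i phi}|] over [0 <= phi <= pi].  As a function of
    [theta], [W] has derivative [(theta / 2) cot (theta / 2)], which is also the
    derivative of [theta log (2 sin (theta / 2)) + Cl2 theta]; both functions
    equal [pi log 2] at [theta = pi].

    [iter_int] integrates [x] innermost, so [x] has to be moved outwards past one
    variable at a time.  At each step the integrand is [P x * q x t], where all
    moments of [P] are finite and the L1 norm of [q x] is bounded uniformly in
    [x], so Fubini's theorem applies for every (not just almost every) value of
    the other variables.

    Jensen's formula comes from the duplication [J (r^2) = 2 J r] of the mean [J r]
    of [log |r + e^{it}|] together with the boundedness of [J] on [[0, 1]]. *)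
Require Import Defs.
From mathcomp Require Import all_boot all_order all_algebra.
From mathcomp Require Import all_classical all_reals all_analysis.
From mathcomp Require Import measurable_realfun complex.
From mathcomp Require Import ring lra zify.
Set Implicit Arguments.
Unset Strict Implicit.
Unset Printing Implicit Defensive.
Import Order.TTheory GRing.Theory Num.Theory numFieldNormedType.Exports.
Local Open Scope classical_set_scope.
Local Open Scope ring_scope.

(** * Change of variables and periodicity *)

Section affine_change_of_variables.
Context {R : realType}.
Local Notation mu := (@lebesgue_measure R).

Lemma measurable_affine (c d : R) :
  measurable_fun [set: R] (fun x : R => c * x + d).
Proof.
by apply: measurable_funD => //; exact: mulrl_measurable.
Qed.

(** A positive real factor preserves both infinities, so it distributes even over a difference of
    infinities. Identities for positive and negative parts can then be recombined without
    integrability. *)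
Lemma mule_gt0Br (c : R) (x y : \bar R) : 0 < c ->
  (c%:E * x - c%:E * y = c%:E * (x - y))%E.
Proof.
rewrite -lte_fin => c0; move: x y => [x| |] [y| |] /=;
  rewrite -?EFinB -?EFinM -?EFinB ?mulrBr//=;
  by rewrite ?(gt0_muley c0) ?(gt0_muleNy c0)//= ?addeNy ?addey.
Qed.

Section affine_measure.
Variables (c d : R).
Hypothesis c0 : 0 < c.
Let phi : measurableTypeR R -> measurableTypeR R := fun x => c * x + d.
Let mphi : measurable_fun setT phi.
Proof. exact: measurable_affine. Qed.
Let pushforward_affine : {measure set (measurableTypeR R) -> \bar R} :=
  measure_function_pushforward__canonical__measure_function_Measure mu mphi.

Lemma affine_preimage_itv (x y : R) (b1 b2 : bool) :
  (fun t : R => c * t + d) @^-1` [set` Interval (BSide b1 x) (BSide b2 y)] =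
  [set` Interval (BSide b1 ((x - d) / c)) (BSide b2 ((y - d) / c))].
Proof.
by apply/seteqP; split => t /=; rewrite !in_itv/=; case: b1; case: b2;
  rewrite /= ?ler_pdivrMr// ?ltr_pdivrMr// ?ler_pdivlMr// ?ltr_pdivlMr//
    ?lerBlDr ?lerBrDr ?ltrBlDr ?ltrBrDr (mulrC t).
Qed.

(** By uniqueness of Lebesgue measure it suffices to compare both sides on half-open intervals. *)
Lemma lebesgue_measure_affine (A : set R) : measurable A ->
  mu A = mscale (NngNum (ltW c0)) pushforward_affine A.
Proof.
apply: lebesgue_measure_unique => _ [[a b]] _ <-.
have E := affine_preimage_itv a b false false.
transitivity (c%:E * mu (phi @^-1` `]a, b]%classic))%E; last by [].
have -> : phi @^-1` `]a, b]%classic = `](a - d) / c, (b - d) / c]%classic.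
  exact: E.
rewrite !lebesgue_measure_itv/= !lte_fin ltr_pM2r ?invr_gt0// ltrD2r.
case: ifPn => _; last by rewrite mule0.
rewrite -!EFinB -EFinM; congr EFin.
by field; rewrite gt_eqF.
Qed.

Lemma ge0_integral_affine (f : R -> \bar R) (D : set R) :
  measurable D -> measurable_fun [set: R] f -> (forall y, 0 <= f y)%E ->
  (\int[mu]_(y in D) f y =
   c%:E * \int[mu]_(x in (fun t => c * t + d)%R @^-1` D) f (c * x + d)%R)%E.
Proof.
move=> mD mf f0.
rewrite (@eq_measure_integral _ _ _ _
  (mscale (NngNum (ltW c0)) pushforward_affine)) //=; last first.
  by move=> A mA _; exact: lebesgue_measure_affine.
rewrite ge0_integral_mscale//=; last exact: measurable_funS mf.
by rewrite (ge0_integral_pushforward mphi)//=; exact: measurable_funS mf.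
Qed.

Lemma integral_affine (f : R -> \bar R) (D : set R) :
  measurable D -> measurable_fun [set: R] f ->
  (\int[mu]_(y in D) f y =
   c%:E * \int[mu]_(x in (fun t => c * t + d)%R @^-1` D) f (c * x + d)%R)%E.
Proof.
move=> mD mf.
rewrite [LHS]integralE [X in (_ = _ * X)%E]integralE.
rewrite (ge0_integral_affine mD (measurable_funepos mf))//.
rewrite (ge0_integral_affine mD (measurable_funeneg mf))//.
transitivity (c%:E *
    (\int[mu]_(x in (fun t => c * t + d)%R @^-1` D) (f^\+ (c * x + d)%R) -
     \int[mu]_(x in (fun t => c * t + d)%R @^-1` D) (f^\- (c * x + d)%R)))%E;
  last first.
  by congr (_ * (_ - _))%E; apply: eq_integral => x _; rewrite !unlock.
by rewrite mule_gt0Br.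
Qed.

End affine_measure.

End affine_change_of_variables.

(** * Integrals of periodic and reflected functions *)

Section periodic.
Context {R : realType}.
Local Notation mu := (@lebesgue_measure R).
Local Open Scope ereal_scope.

Lemma integral_itv_affine (c d a b : R) (f : R -> \bar R) :
  (0 < c)%R -> measurable_fun [set: R] f ->
  \int[mu]_(y in `[(c * a + d)%R, (c * b + d)%R]) f y =
  c%:E * \int[mu]_(x in `[a, b]) f (c * x + d)%R.
Proof.
move=> c0 mf; rewrite (integral_affine d c0)//.
by rewrite affine_preimage_itv// !addrK !(mulrC c) !mulfK ?gt_eqF.
Qed.

Lemma integral_itv_shift (d a b : R) (f : R -> \bar R) :
  measurable_fun [set: R] f ->
  \int[mu]_(y in `[(a + d)%R, (b + d)%R]) f y =
  \int[mu]_(x in `[a, b]) f (x + d)%R.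
Proof.
move=> mf; have := integral_itv_affine d a b ltr01 mf; rewrite !mul1r mul1e => ->.
by apply: eq_integral => x _; rewrite mul1r.
Qed.

Lemma ge0_integral_itv_split (a b c : R) (f : R -> \bar R) :
  (a <= b)%R -> (b <= c)%R ->
  measurable_fun [set: R] f -> (forall x, 0 <= f x) ->
  \int[mu]_(x in `[a, c]) f x =
  \int[mu]_(x in `[a, b]) f x + \int[mu]_(x in `[b, c]) f x.
Proof.
move=> ab bc mf f0.
rewrite -(@integral_itv_obnd_cbnd _ b); last exact: measurable_funS mf.
rewrite -ge0_integral_setU//; first last.
- apply/disj_setPS => y [/=]; rewrite 2!in_itv/= => /andP[_ yx] /andP[].
  by rewrite ltNge yx.
- exact: measurable_funS mf.
by rewrite -itv_bndbnd_setU ?bnd_simp.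
Qed.

Lemma ge0_integral_itv_opp (a b : R) (f : R -> \bar R) :
  measurable_fun [set: R] f -> (forall x, 0 <= f x) ->
  \int[mu]_(x in `[a, b]) f x = \int[mu]_(x in `[(- b)%R, (- a)%R]) f (- x)%R.
Proof.
move=> mf f0.
rewrite (_ : `[(- b)%R, (- a)%R]%classic =
    (-%R : _ -> measurableTypeR R) @^-1` `[a, b]%classic); last first.
  by rewrite opp_preimage_itvbndbnd.
rewrite -ge0_integral_pushforward//=; last exact: measurable_funS mf.
by apply: eq_measure_integral => //= A mA AS; exact/esym/lebesgue_measureN.
Qed.

Lemma integral_eq_posneg (c : R) (A B : set R) (f g : R -> \bar R) : (0 < c)%R ->
  \int[mu]_(x in A) f^\+ x = c%:E * \int[mu]_(x in B) g^\+ x ->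
  \int[mu]_(x in A) f^\- x = c%:E * \int[mu]_(x in B) g^\- x ->
  \int[mu]_(x in A) f x = c%:E * \int[mu]_(x in B) g x.
Proof.
by move=> c0 fg1 fg2; rewrite integralE [in RHS]integralE fg1 fg2 mule_gt0Br.
Qed.

Section period_one.
Variable f : R -> \bar R.
Hypothesis mf : measurable_fun [set: R] f.
Hypothesis f1 : forall x, f (x + 1)%R = f x.

Let f_nat x n : f (x + n%:R)%R = f x.
Proof.
by elim: n => [|n IH]; rewrite ?addr0// -natr1 addrA f1.
Qed.

Let f_int x (z : int) : f (x + z%:~R)%R = f x.
Proof.
case: z => n; first exact: f_nat.
by rewrite -[in RHS](subrK n.+1%:R x) f_nat NegzE mulrNz.
Qed.

(** The window [[d, d + 1]] is cut at the integer [n + 1], where [n] is the floor of [d]. Its right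
    piece, moved back by one period, is [[n, d]], and the two pieces glue to [[n, n + 1]]. *)
Lemma ge0_integral_periodic_shift (d : R) : (forall x, 0 <= f x) ->
  \int[mu]_(x in `[0%R, 1%R]) f (x + d)%R = \int[mu]_(x in `[0%R, 1%R]) f x.
Proof.
move=> f0; rewrite -integral_itv_shift// add0r addrC.
have /andP[n1 n2] := floor_itv d.
rewrite -/(Num.floor d) in n1 n2 *.
set n := Num.floor d in n1 n2 *.
have nd : ((n + 1)%:~R <= d + 1)%R by rewrite intrD1 lerD2r.
rewrite (@ge0_integral_itv_split _ (n + 1)%:~R)//; last exact: ltW.
rewrite intrD1.
rewrite (integral_itv_shift 1 n%:~R d mf).
under [X in _ + X]eq_integral do rewrite f1.
rewrite addeC -ge0_integral_itv_split//; last by rewrite -intrD1; exact: ltW.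
rewrite -[X in `[X, _]]add0r [X in `[_, X]]addrC (integral_itv_shift n%:~R 0 1 mf).
by apply: eq_integral => x _; rewrite f_int.
Qed.

(** The substitution [y = 2 x] covers two periods, each with the same integral, and brings the
    factor [1/2]. *)
Lemma ge0_integral_periodic_double : (forall x, 0 <= f x) ->
  \int[mu]_(x in `[0%R, 1%R]) f (2 * x)%R = \int[mu]_(x in `[0%R, 1%R]) f x.
Proof.
move=> f0.
have := integral_itv_affine 0 0 1 (ltr0Sn R 1) mf.
rewrite mulr0 !addr0 mulr1 (@ge0_integral_itv_split 0 1 2)// ?ler1n//.

have -> : \int[mu]_(x in `[1%R, 2%R]) f x =
    \int[mu]_(x in `[0%R, 1%R]) f (x + 1)%R.
  by rewrite -integral_itv_shift// add0r.
under [X in _ + X]eq_integral do rewrite f1.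
under [X in _ * X]eq_integral do rewrite addr0.
rewrite -mule2n -mule_natl => /(congr1 (fun x => (2^-1)%:E * x)).
by rewrite !muleA -!EFinM mulVf// !mul1e.
Qed.

End period_one.

Lemma integral_periodic_shift (f : R -> \bar R) (d : R) :
  measurable_fun [set: R] f -> (forall x, f (x + 1)%R = f x) ->
  \int[mu]_(x in `[0%R, 1%R]) f (x + d)%R = \int[mu]_(x in `[0%R, 1%R]) f x.
Proof.
move=> mf f1; rewrite -[RHS]mul1e; apply: integral_eq_posneg => //.
- rewrite (funepos_comp f (fun x => x + d)%R) mul1e.
  apply: ge0_integral_periodic_shift => //; first exact: measurable_funepos.
  by move=> x; rewrite !unlock f1.
- rewrite (funeneg_comp f (fun x => x + d)%R) mul1e.
  apply: ge0_integral_periodic_shift => //; first exact: measurable_funeneg.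
  by move=> x; rewrite !unlock f1.
Qed.

Lemma integral_periodic_double (f : R -> \bar R) :
  measurable_fun [set: R] f -> (forall x, f (x + 1)%R = f x) ->
  \int[mu]_(x in `[0%R, 1%R]) f (2 * x)%R = \int[mu]_(x in `[0%R, 1%R]) f x.
Proof.
move=> mf f1; rewrite -[RHS]mul1e; apply: integral_eq_posneg => //.
- rewrite (funepos_comp f (fun x => 2 * x)%R) mul1e.
  apply: ge0_integral_periodic_double => //; first exact: measurable_funepos.
  by move=> x; rewrite !unlock f1.
- rewrite (funeneg_comp f (fun x => 2 * x)%R) mul1e.
  apply: ge0_integral_periodic_double => //; first exact: measurable_funeneg.
  by move=> x; rewrite !unlock f1.
Qed.

Lemma ge0_integral_reflect (a : R) (f : R -> \bar R) :
  measurable_fun [set: R] f -> (forall x, 0 <= f x) ->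
  \int[mu]_(x in `[0%R, a]) f (a - x)%R = \int[mu]_(x in `[0%R, a]) f x.
Proof.
move=> mf f0; have mfa : measurable_fun [set: R] (fun x => f (a - x)%R).
  by apply: (measurableT_comp mf); exact: measurable_funB.
rewrite ge0_integral_itv_opp//= oppr0.
rewrite -[X in `[_, X]](subrr a) -[X in `[X, _]]sub0r.
rewrite (integral_itv_shift (- a) 0 a).
  by apply: eq_integral => x _; congr f; ring.
by apply: (measurableT_comp mfa); exact: oppr_measurable.
Qed.

Lemma integral_reflect (a : R) (f : R -> \bar R) : measurable_fun [set: R] f ->
  \int[mu]_(x in `[0%R, a]) f (a - x)%R = \int[mu]_(x in `[0%R, a]) f x.
Proof.
move=> mf; rewrite -[RHS]mul1e; apply: integral_eq_posneg => //.
- rewrite (funepos_comp f (fun x => a - x)%R) mul1e.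
  exact: (ge0_integral_reflect a (measurable_funepos mf) (funepos_ge0 f)).
- rewrite (funeneg_comp f (fun x => a - x)%R) mul1e.
  exact: (ge0_integral_reflect a (measurable_funeneg mf) (funeneg_ge0 f)).
Qed.

Lemma measurable_cos : measurable_fun [set: R] (@cos R).
Proof. by apply: continuous_measurable_fun; exact: continuous_cos. Qed.

Lemma measurable_sin : measurable_fun [set: R] (@sin R).
Proof. by apply: continuous_measurable_fun; exact: continuous_sin. Qed.

(** The reflection [t -> 1 - t] preserves the cosine, so both halves of the period contribute
    equally; on the first half one substitutes [2 pi t]. *)
Lemma ge0_integral_cos2pi (f : R -> \bar R) : measurable_fun [set: R] f ->
  (forall x, 0 <= f x) ->
  \int[mu]_(x in `[0%R, 1%R]) f (cos (2 * pi * x)) =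
  (pi^-1)%:E * \int[mu]_(x in `[0%R, pi]) f (cos x).
Proof.
move=> mf f0.
have p0 : (0 < 2 * @pi R)%R by rewrite mulr_gt0// pi_gt0.
have mc : measurable_fun [set: R] (fun x => f (cos x)).
  by apply: (measurableT_comp mf); exact: measurable_cos.
have m1 : measurable_fun [set: R] (fun x : R => f (cos (2 * pi * x))).
  by apply: (measurableT_comp mc); exact: mulrl_measurable.
have h0 : (0 <= 2^-1 :> R)%R by [].
rewrite (@ge0_integral_itv_split 0 2^-1 1)//; last lra.
have -> : \int[mu]_(x in `[(2^-1)%R, 1%R]) f (cos (2 * pi * x)) =
    \int[mu]_(x in `[0%R, (2^-1)%R]) f (cos (2 * pi * x)).
  rewrite ge0_integral_itv_opp//.
  rewrite (_ : -1 = 0 - 1)%R; last lra.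
  rewrite (_ : - 2^-1 = 2^-1 - 1)%R; last lra.
  rewrite (integral_itv_shift (- 1) 0 2^-1); last first.
    by apply: (measurableT_comp m1); exact: oppr_measurable.
  apply: eq_integral => x _; congr f.
  rewrite (_ : 2 * pi * - (x - 1) = - (2 * pi * x) + pi *+ 2)%R; last first.
    by rewrite mulr2n; ring.
  by rewrite cosD2pi cosN.
rewrite -mule2n -mule_natl.
have := integral_itv_affine 0 0 2^-1 p0 mc.
rewrite !mulr0 !addr0 mulrAC divff// mul1r => ->.
under [X in _ = _ * (_ * X)]eq_integral do rewrite addr0.
have pn0 : (pi != 0 :> R)%R by rewrite gt_eqF// pi_gt0.
rewrite muleA -EFinM; congr (_%:E * _).
by rewrite mulrCA mulVf ?mulr1.
Qed.

Lemma integral_cos2pi (f : R -> \bar R) : measurable_fun [set: R] f ->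
  \int[mu]_(x in `[0%R, 1%R]) f (cos (2 * pi * x)) =
  (pi^-1)%:E * \int[mu]_(x in `[0%R, pi]) f (cos x).
Proof.
move=> mf; apply: integral_eq_posneg; first by rewrite invr_gt0 pi_gt0.
- rewrite (funepos_comp f (fun x => cos (2 * pi * x))) (funepos_comp f cos).
  exact: (ge0_integral_cos2pi (measurable_funepos mf) (funepos_ge0 f)).
- rewrite (funeneg_comp f (fun x => cos (2 * pi * x))) (funeneg_comp f cos).
  exact: (ge0_integral_cos2pi (measurable_funeneg mf) (funeneg_ge0 f)).
Qed.

End periodic.
(** * Integrability of logarithmic singularities on the circle *)

Section fundamental_theorem.
Context {R : realType}.
Local Notation mu := (@lebesgue_measure R).

Lemma is_derive_continuous (F : R -> R) (x df : R) :
  is_derive x 1 F df -> {for x, continuous F}.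
Proof.
by move=> dF; apply: differentiable_continuous; apply/derivable1_diffP; case: dF.
Qed.

Lemma segment_continuous_within (f : R -> R) (a b : R) :
  {in `[a, b], forall x : R, {for x, continuous f}} ->
  {within `[a, b]%classic, continuous f}.
Proof.
move=> cf; apply: continuous_in_subspaceT => x; rewrite inE => xab.
exact: cf.
Qed.

(** The degenerate case [a = b] is included because intervals ending at [pi] may shrink to a point
    later. *)
Lemma integral_is_derive (F f : R -> R) (a b : R) : a <= b ->
  {in `[a, b], forall x : R, is_derive x 1 F (f x)} ->
  {in `[a, b], forall x : R, {for x, continuous f}} ->
  (\int[mu]_(x in `[a, b]) (f x)%:E = (F b - F a)%:E)%E.
Proof.
rewrite le_eqVlt => /predU1P[<- _ _|ab dF cf].
  by rewrite subrr set_itv1 integral_set1.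
have cF x : x \in `[a, b] -> {for x, continuous F}.
  by move=> /dF; exact: is_derive_continuous.
rewrite (continuous_FTC2 ab (F := F))//.
- exact: segment_continuous_within.
- split.
  + by move=> x xab; have [] := dF _ (subset_itv_oo_cc xab).
  + by apply: cvg_at_right_filter; apply: cF; rewrite in_itv/= lexx ltW.
  + by apply: cvg_at_left_filter; apply: cF; rewrite in_itv/= lexx ltW.
- move=> x xab; have dFx := dF _ (subset_itv_oo_cc xab).
  by rewrite derive1E; exact: derive_val.
Qed.

End fundamental_theorem.

(** * An integrable majorant: the inverse square root *)

Section inverse_sqrt.
Context {R : realType}.
Local Notation mu := (@lebesgue_measure R).

(** The value at [0] is [+oo] and not the field convention [0^-1 = 0], so that the function is
    antitone in [|s|] without exception. *)
Definition invsqrte (s : R) : \bar R :=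
  if s == 0 then +oo%E else ((Num.sqrt `|s|)^-1)%:E.

Lemma measurable_sqrt : measurable_fun [set: R] (@Num.sqrt R).
Proof. by apply: continuous_measurable_fun; exact: sqrt_continuous. Qed.

(** Writing [1/x] as [x] times a real power of [x ^+ 2] reduces to measurability of powers and gives
    the right value at [0]. *)
Lemma measurable_inv : measurable_fun [set: R] (fun x : R => x^-1).
Proof.
rewrite (_ : (fun x : R => x^-1) = fun x => x * powR (x ^+ 2) (-1)); last first.
  apply/funext => x; have [->|x0] := eqVneq x 0; first by rewrite invr0 mul0r.
  by rewrite powR_inv1 ?sqr_ge0// expr2 invfM mulrA divff// mul1r.
apply: measurable_funM => //; apply: (measurableT_comp (measurable_powR (-1))).
exact: measurable_funX.
Qed.

Lemma measurable_invsqrte : measurable_fun [set: R] invsqrte.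
Proof.
apply: measurable_fun_ifT => //; first exact: measurable_fun_eqr.
apply/measurable_EFinP; apply: (measurableT_comp measurable_inv).
by apply: (measurableT_comp measurable_sqrt); exact: normr_measurable.
Qed.

Lemma invsqrte_ge0 s : (0 <= invsqrte s)%E.
Proof. by rewrite /invsqrte; case: ifPn => // _; rewrite lee_fin invr_ge0. Qed.

Lemma le_invsqrte s t : `|s| <= `|t| -> (invsqrte t <= invsqrte s)%E.
Proof.
rewrite /invsqrte; have [->|s0] := eqVneq s 0; first by rewrite leey.
have s1 : 0 < `|s| by rewrite normr_gt0.
move=> st; have t1 : 0 < `|t| by exact: lt_le_trans st.
rewrite ifN -?normr_gt0// lee_fin lef_pV2 ?posrE ?sqrtr_gt0//.
exact: ler_wsqrtr.
Qed.

(** The primitive [2 sqrt x] is used on [[1/(n+1), a]], away from the singularity, followed by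
    monotone convergence as [n] grows. *)
Lemma integral_invsqrte (a : R) : 0 < a ->
  (\int[mu]_(x in `[0%R, a]) invsqrte x <= (2 * Num.sqrt a)%:E)%E.
Proof.
move=> a0; have mi D : measurable_fun D invsqrte.
  exact: measurable_funS measurable_invsqrte.
rewrite -integral_itv_obnd_cbnd//.
have -> : `]0, a]%classic = \bigcup_n `[(n.+1%:R^-1 : R), a]%classic :> set R.
  apply/seteqP; split => x /=.
    rewrite in_itv/= => /andP[x0 xa].
    have [n nx] := ltr_add_invr x0.
    by exists n => //=; rewrite in_itv/= xa ltW//; move: nx; rewrite add0r.
  move=> [n _] /=; rewrite !in_itv/= => /andP[nx ->]; rewrite andbT.
  by rewrite (lt_le_trans _ nx).
have nd : nondecreasing_seq (fun n => `[(n.+1%:R^-1 : R), a]%classic : set R).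
  move=> m n mn; rewrite subsetEset => x /=; rewrite !in_itv/=.
  move=> /andP[mx ->]; rewrite andbT (le_trans _ mx)//.
  by rewrite lef_pV2 ?posrE// ler_nat.
have cv : (\int[mu]_(x in `[(n.+1%:R^-1)%R, a]%classic) invsqrte x
    @[n --> \oo] -->
    \int[mu]_(x in \bigcup_n `[(n.+1%:R^-1)%R, a]%classic) invsqrte x)%E.
  apply: ge0_nondecreasing_set_cvg_integral => //.
  - by move=> n; exact: mi.
  - by move=> n x _; exact: invsqrte_ge0.
rewrite -(cvg_lim _ cv)//.
apply: lime_le; first by apply/cvg_ex; eexists; exact: cv.
apply: nearW => n /=.
have [na|an] := leP n.+1%:R^-1 a; last first.
  by rewrite set_itv_ge ?bnd_simp -?ltNge// integral_set0 lee_fin mulr_ge0.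
have n0 : 0 < n.+1%:R^-1 :> R by rewrite invr_gt0.
under eq_integral => x.
  rewrite inE/= in_itv/= => /andP[nx _].
  have x0 : 0 < x by exact: lt_le_trans nx.
  rewrite /invsqrte gt_eqF// gtr0_norm//.
  over.
rewrite (@integral_is_derive _ (fun x => 2 * Num.sqrt x))//.
- by rewrite lee_fin gerBl mulr_ge0.
- move=> x; rewrite in_itv/= => /andP[nx _].
  have x0 : 0 < x by exact: lt_le_trans nx.
  have dx := is_derive1_sqrt x0.
  apply: (@is_derive_eq _ _ _ (2 *: @Num.sqrt R)).
  by rewrite /GRing.scale/= invfM mulrA divff// mul1r.
- move=> x; rewrite in_itv/= => /andP[nx _].
  have x0 : 0 < x by exact: lt_le_trans nx.
  apply: continuousV; last exact: sqrt_continuous.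
  by rewrite gt_eqF// sqrtr_gt0.
Qed.

(** One has [sin x = 2 sin (x/2) cos (x/2)] and, by the mean value theorem,
    [sin (x/2) = (x/2) cos c]. Both angles lie in [[0, pi/4]], so both cosines are at least
    [1/2]. *)
Lemma sin_ge_quarter (x : R) : 0 <= x <= pi / 2 -> x / 4 <= sin x.
Proof.
move=> /andP[x0 x1].
have [c] := @MVT_segment _ (@sin R) (@cos R) 0 (x / 2)
  (divr_ge0 x0 (ler0n _ 2)) (fun x _ => is_derive_sin x)
  (continuous_subspaceT (@continuous_sin R)).
rewrite in_itv/= sin0 !subr0 => /andP[c0 cx] sE.
have ch y : 0 <= y <= x / 2 -> 2^-1 <= cos y.
  move=> /andP[y0 yx].
  have p0 := @pi_gt0 R.
  have cy : 0 <= cos y by apply: cos_ge0_pihalf; lra.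
  (* Nonnegativity of [cos (2 y)] gives [cos y ^+ 2 >= 1/2], whence [cos y >= 1/2]. *)
  have : 0 <= cos (y *+ 2) by apply: cos_ge0_pihalf; rewrite (mulr2n y); lra.
  rewrite cos_mulr2n subr_ge0 (mulr2n (cos y ^+ 2)) => h.
  by nra.
have -> : sin x = 2 * (sin (x / 2) * cos (x / 2)).
  have {1}-> : x = (x / 2) *+ 2 by rewrite -mulr_natr; lra.
  by rewrite sin_mulr2n -mulr_natr; ring.
have h1 := ch c ltac:(lra); have h2 := ch (x / 2) ltac:(lra).
rewrite sE.
have : 4^-1 <= cos c * cos (x / 2) by nra.
by nra.
Qed.

Lemma integral_invsqrte_sin :
  (\int[mu]_(x in `[0%R, pi]) invsqrte (sin x) < +oo)%E.
Proof.
pose f (x : R) := invsqrte (x / 4).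
have f0 x : (0 <= f x)%E by exact: invsqrte_ge0.
have mf : measurable_fun [set: R] f.
  by apply: (measurableT_comp measurable_invsqrte); exact: mulrr_measurable.
have mfp : measurable_fun [set: R] (fun x => f (pi - x)).
  by apply: (measurableT_comp mf); exact: measurable_funB.
have fy : (\int[mu]_(x in `[0%R, pi]) f x < +oo)%E.
  have := integral_itv_affine 0 0 (pi / 4) (ltr0Sn R 3) mf.
  rewrite mulr0 !addr0 mulrC mulfVK// => ->.
  under eq_integral => x _ do rewrite /f addr0 mulrC mulKf//.
  apply: lte_mul_pinfty => //.
  apply: (le_lt_trans (integral_invsqrte _)); last exact: ltry.
  by rewrite divr_gt0// pi_gt0.
(* The two terms control the zeros of the sine at [0] and at [pi]; on each half of the interval one
   of them alone is a majorant. *)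
apply: (@le_lt_trans _ _ (\int[mu]_(x in `[0%R, pi]) (f x + f (pi - x)%R)%E)%E).
  apply: ge0_le_integral => //.
  - by move=> x _; exact: invsqrte_ge0.
  - apply: (@measurable_funS _ _ _ _ setT) => //.
    exact: (measurableT_comp measurable_invsqrte measurable_sin).
  - apply: (@measurable_funS _ _ _ _ setT) => //.
    exact: emeasurable_funD.
  - move=> x /=; rewrite in_itv/= => /andP[x0 xp].
    have [xh|xh] := leP x (pi / 2).
      apply: (@le_trans _ _ (f x)); last by rewrite leeDl.
      apply: le_invsqrte; have h := @sin_ge_quarter x ltac:(lra).
      by rewrite !ger0_norm//; lra.
    apply: (@le_trans _ _ (f (pi - x))); last by rewrite leeDr.
    apply: le_invsqrte; have h := @sin_ge_quarter (pi - x) ltac:(lra).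
    have sE : sin (pi - x) = sin x.
      by rewrite sinB sinpi cospi mul0r sub0r mulN1r opprK.
    by rewrite sE in h; rewrite !ger0_norm//; lra.
rewrite ge0_integralD//; last 2 first.
- exact: measurable_funS mf.
- exact: measurable_funS mfp.
by rewrite integral_reflect// lte_add_pinfty.
Qed.

End inverse_sqrt.

(** * The logarithm of the modulus along a circle *)

Section log_modulus.
Context {R : realType}.
Local Notation mu := (@lebesgue_measure R).

Definition cos2pi (t : R) : R := cos (2 * pi * t).
Definition sin2pi (t : R) : R := sin (2 * pi * t).

(* [ln |u + i v|]; it is [0] at the origin, as in [multi_mahler] *)
Definition lnabs (u v : R) : R := ln (u ^+ 2 + v ^+ 2) / 2.

Lemma ln_normc (u v : R) : ln (Normc.normc (u +i* v)%C) = lnabs u v.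
Proof.
rewrite /= /lnabs; have := addr_ge0 (sqr_ge0 u) (sqr_ge0 v).
rewrite le_eqVlt => /predU1P[<-|w0].
  by rewrite sqrtr0 ln0// mul0r.
by rewrite -powR12_sqrt ?ltW// ln_powR mulrC.
Qed.

Lemma cos2pi_periodic t : cos2pi (t + 1) = cos2pi t.
Proof.
rewrite /cos2pi (_ : 2 * pi * (t + 1) = 2 * pi * t + pi *+ 2) ?cosD2pi//.
by rewrite -(mulr_natr pi); ring.
Qed.

Lemma measurable_cos2pi : measurable_fun [set: R] cos2pi.
Proof. by apply: (measurableT_comp measurable_cos); exact: mulrl_measurable. Qed.

Lemma measurable_sin2pi : measurable_fun [set: R] sin2pi.
Proof. by apply: (measurableT_comp measurable_sin); exact: mulrl_measurable. Qed.

Lemma measurable_lnabs d (T : measurableType d) (a b : T -> R) :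
  measurable_fun [set: T] a -> measurable_fun [set: T] b ->
  measurable_fun [set: T] (fun t => lnabs (a t) (b t)).
Proof.
move=> ma mb; apply: measurable_funM => //.
apply: (measurableT_comp (@measurable_ln R)).
by apply: measurable_funD; exact: measurable_funX.
Qed.

Lemma polar_coordinates (u v : R) : exists a : R,
  u = Num.sqrt (u ^+ 2 + v ^+ 2) * cos2pi a /\
  v = Num.sqrt (u ^+ 2 + v ^+ 2) * sin2pi a.
Proof.
set w := u ^+ 2 + v ^+ 2; set r := Num.sqrt w.
have u2 := sqr_ge0 u; have v2 := sqr_ge0 v.
have w0 : 0 <= w by exact: addr_ge0.
have [w00|wn0] := eqVneq w 0.
  exists 0; rewrite /r w00 sqrtr0 !mul0r.
  have : (u ^+ 2 == 0) && (v ^+ 2 == 0) by rewrite -paddr_eq0// -/w w00.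
  by rewrite !sqrf_eq0 => /andP[/eqP -> /eqP ->].
have r0 : 0 < r by rewrite sqrtr_gt0 lt_neqAle eq_sym wn0.
have r2 : r ^+ 2 = w by rewrite sqr_sqrtr.
have ur : -1 <= u / r <= 1.
  rewrite -ler_norml normrM normfV (gtr0_norm r0) ler_pdivrMr// mul1r.
  by rewrite -sqrtr_sqr ler_wsqrtr// lerDl.
have [b [bu bv]] : exists b, u = r * cos b /\ v = r * sin b.
  have cE : u = r * cos (acos (u / r)).
    by rewrite acosK ?in_itv//= mulrC divfK// gt_eqF.
  have sE : `|v| = r * sin (acos (u / r)).
    rewrite sin_acos// -[in LHS]sqrtr_sqr.
    rewrite -[X in X * _](ger0_norm (ltW r0)) -sqrtr_sqr -sqrtrM ?sqr_ge0//.
    congr Num.sqrt; rewrite mulrBr mulr1 -exprMn mulrC divfK ?gt_eqF// r2 /w.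
    by ring.
  (* The arc cosine gives the angle up to sign, and the sign is that of [v]. *)
  have [v0|v0] := leP 0 v.
    by exists (acos (u / r)); rewrite -cE -sE ger0_norm.
  exists (- acos (u / r)); rewrite cosN sinN -cE mulrN -sE ltr0_norm//.
  by rewrite opprK.
exists (b / (2 * pi)); rewrite /cos2pi /sin2pi mulrCA divff ?mulr1//.
by rewrite mulf_neq0// gt_eqF// pi_gt0.
Qed.

Lemma sqr_modulus_polar (r a t : R) :
  (r * cos2pi a + cos2pi t) ^+ 2 + (r * sin2pi a + sin2pi t) ^+ 2 =
  r ^+ 2 + 2 * r * cos2pi (t - a) + 1.
Proof.
have h1 := cos2Dsin2 (2 * pi * a); have h2 := cos2Dsin2 (2 * pi * t).
rewrite /cos2pi /sin2pi mulrBr cosB.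
rewrite -[r ^+ 2 in RHS]mulr1 -[X in _ = _ * X + _ + _]h1.
by rewrite -[X in _ = _ + _ + X]h2; ring.
Qed.

(** Rotation invariance: with [u + i v] of argument [2 pi a], the squared modulus depends on [t - a]
    only, and the shift by [a] is absorbed by periodicity. A general [h] serves the logarithm, its
    absolute powers and its positive part alike. *)
Lemma integral_circle (h : R -> \bar R) (u v : R) : measurable_fun [set: R] h ->
  (\int[mu]_(t in `[0%R, 1%R])
     h ((u + cos2pi t) ^+ 2 + (v + sin2pi t) ^+ 2)%R =
  \int[mu]_(t in `[0%R, 1%R])
     h (u ^+ 2 + v ^+ 2 + 2 * Num.sqrt (u ^+ 2 + v ^+ 2) * cos2pi t + 1)%R)%E.
Proof.
move=> mh; have [a [ua va]] := polar_coordinates u v.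
set r := Num.sqrt _ in ua va *.
have r2 : u ^+ 2 + v ^+ 2 = r ^+ 2.
  by rewrite sqr_sqrtr// addr_ge0// sqr_ge0.
rewrite r2 ua va.
under eq_integral do rewrite sqr_modulus_polar.
rewrite (@integral_periodic_shift _ (fun t => h (r ^+ 2 + 2 * r * cos2pi t + 1)))//.
  apply: (measurableT_comp mh); apply: measurable_funD => //.
  apply: measurable_funD => //; apply: measurable_funM => //.
  exact: measurable_cos2pi.
by move=> x; rewrite cos2pi_periodic.
Qed.

(** This is [y <= exp y] at [y = |x| / (2 p)], raised to the power [p]. Applied to a logarithm, it
    bounds every moment by the same small power of the modulus. *)
Lemma ln_pow_bound (p : nat) (x : R) :
  `|x| ^+ p <= (2 * p)%:R ^+ p * expR (`|x| / 2).
Proof.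
case: p => [|p]; first by rewrite !expr0 mul1r -expR0 ler_expR divr_ge0.
have p0 : 0 < (2 * p.+1)%:R :> R by rewrite ltr0n.
have h : `|x| / (2 * p.+1)%:R <= expR (`|x| / (2 * p.+1)%:R).
  by apply: le_trans (expR_ge1Dx _); rewrite lerDr.
have -> : `|x| / 2 = p.+1%:R * (`|x| / (2 * p.+1)%:R).
  by rewrite natrM; field; rewrite addrC natr1 pnatr_eq0.
rewrite expRM_natl -exprMn; apply: lerXn2r; rewrite ?nnegrE ?mulr_ge0 ?expR_ge0//.
by rewrite mulrC -ler_pdivrMr.
Qed.

(* [|r + e^{ix}| >= |sin x|], so the singularity is at worst [|sin x|^(-1/2)] *)
Lemma lnabs_pow_bound (p : nat) (r x : R) : 0 <= r ->
  (((`|ln (r ^+ 2 + 2 * r * cos x + 1) / 2| ^+ p)%:E) <=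
  ((2 * p)%:R ^+ p)%:E * ((expR (2 * (r ^+ 2 + 1)))%:E + invsqrte (sin x)))%E.
Proof.
move=> r0; set w := r ^+ 2 + 2 * r * cos x + 1.
have h := cos2Dsin2 x.
have cx1 := cos_le1 x; have cxN1 := cos_geN1 x.
have ws : sin x ^+ 2 <= w.
  by rewrite /w; have := sqr_ge0 (r + cos x); nra.
have wM : w <= 2 * (r ^+ 2 + 1).
  by rewrite /w; have := sqr_ge0 (r - 1); nra.
apply: (@le_trans _ _
    ((2 * p)%:R ^+ p * expR (`|ln w / 2| / 2))%:E).
  by rewrite lee_fin; exact: ln_pow_bound.
rewrite EFinM lee_wpmul2l// ?lee_fin ?exprn_ge0//.
have E1 : 0 < expR (2 * (r ^+ 2 + 1)) by exact: expR_gt0.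
(* Since [w >= sin x ^+ 2], the first case is [w = 0], where [ln] returns [0] by convention. *)
have [wle|wgt] := leP w 0.
  rewrite ln0// mul0r normr0 mul0r expR0.
  apply: (@le_trans _ _ (expR (2 * (r ^+ 2 + 1)))%:E).
    by rewrite lee_fin -expR0 ler_expR mulr_ge0// addr_ge0// sqr_ge0.
  by rewrite leeDl// invsqrte_ge0.
have [lw|lw] := leP 0 (ln w).
  apply: (@le_trans _ _ (expR (2 * (r ^+ 2 + 1)))%:E).
    rewrite lee_fin ler_expR ger0_norm ?divr_ge0//.
    by have := ln_sublinear wgt; lra.
  by rewrite leeDl// invsqrte_ge0.
(* Here [ln w < 0], so the exponential is [w^(-1/4)], which is at most [|sin x|^(-1/2)] because
   [sin x ^+ 2 <= w]. *)
apply: (@le_trans _ _ (invsqrte (sin x))); last first.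
  by rewrite leeDr// lee_fin ltW.
rewrite /invsqrte; case: ifPn => [_|s0]; first by rewrite leey.
rewrite lee_fin.
have s1 : 0 < `|sin x| by rewrite normr_gt0.
rewrite -powR12_sqrt// -powRN /powR gt_eqF// ler_expR.
rewrite ltr0_norm; last by rewrite pmulr_llt0.
have : ln (`|sin x| ^+ 2) <= ln w.
  by rewrite ler_ln ?posrE ?exprn_gt0// real_normK ?num_real.
rewrite lnXn// mulr2n.
by lra.
Qed.

Definition circle_invsqrt : R :=
  fine (\int[mu]_(x in `[0%R, pi]) invsqrte (sin x)).

(** It depends on the centre only through its squared modulus [r2] and is nondecreasing in it, hence
    gives bounds uniform over bounded sets of centres. *)
Definition lnabs_moment_bound (p : nat) (r2 : R) : R :=
  (2 * p)%:R ^+ p * (expR (2 * (r2 + 1)) + pi^-1 * circle_invsqrt).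

Lemma integral_lnabs_pow (p : nat) (u v : R) :
  (\int[mu]_(t in `[0%R, 1%R])
    (`|lnabs (u + cos2pi t) (v + sin2pi t)| ^+ p)%:E <=
   (lnabs_moment_bound p (u ^+ 2 + v ^+ 2))%:E)%E.
Proof.
have mF : measurable_fun [set: R] (fun w : R => (`|ln w / 2| ^+ p)%:E).
  apply/measurable_EFinP; apply: measurable_funX.
  apply: (measurableT_comp (@normr_measurable R setT)).
  by apply: measurable_funM => //; exact: measurable_ln.
rewrite /lnabs (integral_circle u v mF).
set w := u ^+ 2 + v ^+ 2; set r := Num.sqrt w.
have wr : w = r ^+ 2 by rewrite sqr_sqrtr// addr_ge0// sqr_ge0.
have mG : measurable_fun [set: R]
    (fun c : R => (`|ln (w + 2 * r * c + 1) / 2| ^+ p)%:E).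
  apply: (measurableT_comp mF); apply: measurable_funD => //.
  exact: measurable_funD.
have msin : measurable_fun `[0%R, pi] (fun x : R => invsqrte (sin x)).
  apply: (@measurable_funS _ _ _ _ setT) => //.
  exact: (measurableT_comp measurable_invsqrte measurable_sin).
have mE (e : R) : measurable_fun `[0%R, pi]
    (cst e%:E \+ (fun x : R => invsqrte (sin x)))%E.
  apply: emeasurable_funD; [exact: measurable_cst|exact: msin].
rewrite /cos2pi (integral_cos2pi mG) wr.
have S0 : (0 <= \int[mu]_(x in `[0%R, pi]) invsqrte (sin x))%E.
  by apply: integral_ge0 => x _; exact: invsqrte_ge0.
have SE : (circle_invsqrt%:E = \int[mu]_(x in `[0%R, pi]) invsqrte (sin x))%E.
  by rewrite /circle_invsqrt fineK// ge0_fin_numE// integral_invsqrte_sin.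
have -> : (lnabs_moment_bound p (r ^+ 2))%:E = ((pi^-1)%:E *
    \int[mu]_(x in `[0%R, pi]) (((2 * p)%:R ^+ p)%:E *
     ((expR (2 * (r ^+ 2 + 1)))%:E + invsqrte (sin x))))%E.
  rewrite ge0_integralZl//; last 2 first.
  - exact: mE.
  - by move=> x _; rewrite adde_ge0// ?invsqrte_ge0// lee_fin expR_ge0.
  rewrite ge0_integralD//; last by move=> x _; exact: invsqrte_ge0.
  rewrite integral_cst//= lebesgue_measure_itv/= lte_fin pi_gt0 -SE.
  rewrite -[RHS]/((pi^-1 * ((2 * p)%:R ^+ p *
    (expR (2 * (r ^+ 2 + 1)) * (pi + - 0) + circle_invsqrt)))%:E).
  congr EFin; rewrite oppr0 addr0 /lnabs_moment_bound [RHS]mulrCA.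
  rewrite [X in _ = _ * X]mulrDr.
  congr (_ * (_ + _)).
  by rewrite mulrCA mulVf ?mulr1// gt_eqF// pi_gt0.
apply: lee_wpmul2l; first by rewrite lee_fin invr_ge0 pi_ge0.
apply: ge0_le_integral => //.
- apply: (@measurable_funS _ _ _ _ setT) => //.
  by rewrite -wr; exact: (measurableT_comp mG measurable_cos).
- by apply: measurable_funeM; exact: mE.
- by move=> x _; apply: lnabs_pow_bound; exact: sqrtr_ge0.
Qed.

End log_modulus.
(** * Jensen's formula *)

Section jensen.
Context {R : realType}.
Local Notation mu := (@lebesgue_measure R).

Lemma measurable_lnabs_circle (u v : R) :
  measurable_fun [set: R] (fun t => lnabs (u + cos2pi t) (v + sin2pi t)).
Proof.
apply: measurable_lnabs.
  by apply: measurable_funD => //; exact: measurable_cos2pi.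
by apply: measurable_funD => //; exact: measurable_sin2pi.
Qed.

Lemma integrable_lnabs_pow (p : nat) (u v : R) :
  mu.-integrable `[0, 1]
    (EFin \o (fun t => lnabs (u + cos2pi t) (v + sin2pi t) ^+ p)).
Proof.
apply/integrableP; split.
  apply/measurable_EFinP; apply: (@measurable_funS _ _ _ _ setT) => //.
  by apply: measurable_funX; exact: measurable_lnabs_circle.
under eq_integral do rewrite /= normrX.
exact: (le_lt_trans (integral_lnabs_pow p u v) (ltry _)).
Qed.

Lemma integrable_lnabs (u v : R) :
  mu.-integrable `[0, 1] (EFin \o (fun t => lnabs (u + cos2pi t) (v + sin2pi t))).
Proof. exact: (integrable_lnabs_pow 1). Qed.

Definition ln_circle (r c : R) : R := ln (r ^+ 2 + 2 * r * c + 1) / 2.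

Lemma measurable_ln_circle (r : R) : measurable_fun [set: R] (ln_circle r).
Proof.
apply: measurable_funM => //; apply: (measurableT_comp (@measurable_ln R)).
apply: measurable_funD => //; apply: measurable_funD => //; exact: measurable_funM.
Qed.

Lemma lnabs_circle_real (r t : R) :
  lnabs (r + cos2pi t) (0 + sin2pi t) = ln_circle r (cos2pi t).
Proof.
rewrite /lnabs /ln_circle add0r; congr (ln _ / 2).
by rewrite -[X in _ = _ + X](cos2Dsin2 (2 * pi * t)) /cos2pi /sin2pi; ring.
Qed.

Definition mean_ln_circle (r : R) : R :=
  Rintegral mu `[0, 1] (fun t => ln_circle r (cos2pi t)).

Lemma integrable_ln_circle (r : R) :
  mu.-integrable `[0, 1] (EFin \o (fun t => ln_circle r (cos2pi t))).
Proof.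
apply: eq_integrable (integrable_lnabs r 0) => //.
by move=> t _ /=; rewrite lnabs_circle_real.
Qed.

Lemma mean_lnabs_circle (u v : R) :
  Rintegral mu `[0, 1] (fun t => lnabs (u + cos2pi t) (v + sin2pi t)) =
  mean_ln_circle (Num.sqrt (u ^+ 2 + v ^+ 2)).
Proof.
rewrite /Rintegral /lnabs (@integral_circle _ (fun w => (ln w / 2)%:E)).
  congr fine; apply: eq_integral => t _; rewrite /ln_circle.
  by rewrite sqr_sqrtr// addr_ge0// sqr_ge0.
by apply/measurable_EFinP; apply: measurable_funM => //; exact: measurable_ln.
Qed.

(** A shift by half a period changes the sign of the cosine, which amounts to changing the sign of
    [r]. *)
Lemma mean_ln_circleN (r : R) : mean_ln_circle (- r) = mean_ln_circle r.
Proof.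
rewrite /mean_ln_circle /Rintegral; congr fine.
rewrite -[RHS](@integral_periodic_shift _ _ 2^-1); last 2 first.
- apply/measurable_EFinP.
  exact: (measurableT_comp (measurable_ln_circle r) measurable_cos2pi).
- by move=> x; rewrite cos2pi_periodic.
apply: eq_integral => t _; congr (_%:E); rewrite /ln_circle.
have -> : cos2pi (t + 2^-1) = - cos2pi t.
  by rewrite /cos2pi mulrDr (mulrC 2 pi) mulfK// cosDpi.
by congr (ln _ / 2); ring.
Qed.

Lemma normr_mean_ln_circle (r : R) :
  `|mean_ln_circle r| <= lnabs_moment_bound 1 (r ^+ 2).
Proof.
apply: le_trans; first exact: (le_normr_Rintegral _ (integrable_ln_circle r)).
rewrite -lee_fin fineK; last first.
  by apply: integrable_fin_num => //; exact/integrable_norm/integrable_ln_circle.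
have := integral_lnabs_pow 1 r 0.
rewrite expr0n/= addr0.
by under eq_integral do rewrite expr1 lnabs_circle_real.
Qed.

(* Duplication: [(r + e^{it})(r - e^{it}) = r^2 - e^{2it}] *)
Lemma mean_ln_circle_sqr (r : R) : 0 <= r ->
  mean_ln_circle (r ^+ 2) = 2 * mean_ln_circle r.
Proof.
move=> r0; rewrite -[LHS]mean_ln_circleN mulr_natl mulr2n.
rewrite -[X in _ = X + _]mean_ln_circleN.
rewrite /mean_ln_circle -RintegralD//; try exact: integrable_ln_circle.
rewrite /Rintegral; congr fine.
pose h1 (c : R) := (ln_circle (- r) c + ln_circle r c)%:E.
pose h2 (c : R) := (ln_circle (- (r ^+ 2)) (2 * c ^+ 2 - 1))%:E.
have mh1 : measurable_fun [set: R] h1.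
  by apply/measurable_EFinP; apply: measurable_funD; exact: measurable_ln_circle.
have mh2 : measurable_fun [set: R] h2.
  apply/measurable_EFinP; apply: (measurableT_comp (measurable_ln_circle _)).
  by apply: measurable_funB => //; apply: measurable_funM => //.
(* Replacing [t] by [2 t] preserves the mean and expresses the left side through
   [cos (2 x) = 2 cos x ^+ 2 - 1], so that both sides are integrals of functions of the same
   cosine. *)
transitivity (\int[mu]_(t in `[0%R, 1%R]) h2 (cos2pi t))%E.
  rewrite -(@integral_periodic_double _
      (fun t => (ln_circle (- r ^+ 2) (cos2pi t))%:E)); last 2 first.
  - apply/measurable_EFinP.
    exact: (measurableT_comp (measurable_ln_circle _) measurable_cos2pi).
  - by move=> t; rewrite cos2pi_periodic.
  apply: eq_integral => t _; rewrite /h2; congr (ln_circle _ _)%:E; rewrite /cos2pi.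
  have -> : 2 * pi * (2 * t) = (2 * pi * t) *+ 2 :> R.
    by rewrite -[RHS]mulr_natl; ring.
  by rewrite cos_mulr2n (mulr_natl (cos (2 * pi * t) ^+ 2)).
rewrite /cos2pi (integral_cos2pi mh1) (integral_cos2pi mh2); congr (_ * _)%E.
(* The endpoints are removed because a modulus can vanish there (when [r = 1]), and the logarithm of
   a product splits only for positive factors; inside, [sin x > 0]. *)
rewrite !(@integral_itv_bndoo _ _ _ _ true false); last 2 first.
- apply: (@measurable_funS _ _ _ _ setT) => //.
  exact: (measurableT_comp mh1 measurable_cos).
- apply: (@measurable_funS _ _ _ _ setT) => //.
  exact: (measurableT_comp mh2 measurable_cos).
apply: eq_integral => x; rewrite inE/= in_itv/= => xp.
have sx : 0 < sin x by exact: sin_gt0_pi.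
have h := cos2Dsin2 x.
rewrite /h1 /h2 /ln_circle -mulrDl; congr (_ / 2)%:E.
rewrite -lnM ?posrE; first by congr ln; ring.
- by have := sqr_ge0 (- r + cos x); nra.
- by have := sqr_ge0 (r + cos x); nra.
Qed.

(* The means at [r^(2^n)] are [2^n] times the mean at [r], yet bounded. *)
Lemma mean_ln_circle_le1 (r : R) : 0 <= r <= 1 -> mean_ln_circle r = 0.
Proof.
move=> r01.
have [C C0 HC] : exists2 C, 0 < C &
    forall s, 0 <= s <= 1 -> `|mean_ln_circle s| <= C.
  (* The first moment bound is nondecreasing in the squared radius, so its value at [1] serves for
     all of [[0, 1]]. *)
  exists (`|lnabs_moment_bound 1 1| + 1) => [|s s01]; first by rewrite ltr_wpDl.
  apply: (le_trans (normr_mean_ln_circle s)).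
  apply: (@le_trans _ _ (lnabs_moment_bound 1 1)).
    rewrite /lnabs_moment_bound !expr1 ler_pM2l// lerD2r ler_expR.
    by case/andP: s01 => s0 s1; nra.
  by rewrite (le_trans (ler_norm _))// lerDl.
have H n s : 0 <= s <= 1 -> 2 ^+ n * `|mean_ln_circle s| <= C.
  elim: n s => [|n IH] s s01; first by rewrite mul1r HC.
  have := IH (s ^+ 2); case/andP: s01 => s0 s1.
  rewrite mean_ln_circle_sqr// normrM ger0_norm// mulrA -exprSr; apply.
  by rewrite sqr_ge0/= expr_le1.
apply/eqP; rewrite -normr_eq0; apply/negPn/negP => n0.
have j0 : 0 < `|mean_ln_circle r| by rewrite lt_neqAle eq_sym n0 normr_ge0.
have [n Cn] : exists n : nat, C / `|mean_ln_circle r| < n%:R.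
  by eexists; exact: truncnS_gt.
have := H n _ r01; rewrite leNgt => /negP; apply.
rewrite -ltr_pdivrMr//; apply: (lt_le_trans Cn).
by rewrite -natrX ler_nat ltnW// ltn_expl.
Qed.

(* [|r + e^{it}| = r |1/r + e^{it}|] *)
Lemma mean_ln_circle_gt1 (r : R) : 1 < r -> mean_ln_circle r = ln r.
Proof.
move=> r1; have r0 : 0 < r by exact: lt_trans r1.
have ri : 0 < r^-1 < 1 by rewrite invr_gt0 r0 invf_lt1.
rewrite -[RHS]addr0 -(@mean_ln_circle_le1 r^-1); last lra.
have lnE t : ln_circle r (cos2pi t) = ln r + ln_circle r^-1 (cos2pi t).
  have c1 := cos_geN1 (2 * pi * t); have c2 := cos_le1 (2 * pi * t).
  rewrite -/(cos2pi t) in c1 c2.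
  have -> : ln r = ln (r ^+ 2) / 2 by rewrite lnXn// -(mulr_natr (ln r)) mulfK.
  rewrite /ln_circle -mulrDl; congr (_ / 2).
  rewrite -lnM ?posrE ?exprn_gt0//.
    by congr ln; field; rewrite gt_eqF.
  have : 0 < (1 - r^-1) ^+ 2 by rewrite exprn_gt0// subr_gt0; lra.
  by nra.
rewrite /mean_ln_circle; under eq_Rintegral do rewrite lnE.
rewrite RintegralD//; last exact: integrable_ln_circle.
  rewrite Rintegral_cst//=.
  by rewrite lebesgue_measure_itv/= lte_fin ltr01/= oppr0 addr0 mulr1.
apply: continuous_compact_integrable; first exact: segment_compact.
by apply: continuous_subspaceT => x; exact: cvg_cst.
Qed.

Definition lnabsp (u v : R) : R := Num.max 0 (lnabs u v).

Lemma jensen (u v : R) :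
  Rintegral mu `[0, 1] (fun t => lnabs (u + cos2pi t) (v + sin2pi t)) =
  lnabsp u v.
Proof.
rewrite mean_lnabs_circle /lnabsp /lnabs; set w := _ + _.
have w0 : 0 <= w by rewrite addr_ge0// sqr_ge0.
have [w1|w1] := leP w 1.
  rewrite mean_ln_circle_le1; last first.
    by rewrite sqrtr_ge0/= -sqrtr1 ler_wsqrtr.
  by rewrite max_l// pmulr_lle0// ln_le0.
rewrite mean_ln_circle_gt1; last first.
  by rewrite -[ltLHS]sqrtr1 ltr_sqrt// (lt_trans _ w1).
rewrite max_r; last first.
  by have := ln_ge0 (ltW w1); lra.
by rewrite -powR12_sqrt// ln_powR mulrC.

Qed.

End jensen.
(** * Reduction of the iterated integral *)

Section fubini.
Context {R : realType}.
Local Notation mu := (@lebesgue_measure R).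

Lemma integral_mk_indic (D : set R) (f : R -> \bar R) : measurable D ->
  (\int[mu]_(x in D) f x = \int[mu]_x (f x * (\1_D x)%:E))%E.
Proof.
move=> mD; rewrite integral_mkcond; apply: eq_integral => x _.
by rewrite /patch indicE; case: ifP; rewrite ?mule1 ?mule0.
Qed.

Lemma measurable_integral_ge0 (E : set R) (K : R -> R -> R) :
  measurable E -> measurable_fun [set: R * R] (fun z => K z.1 z.2) ->
  (forall x t, 0 <= K x t) ->
  measurable_fun [set: R] (fun x => \int[mu]_(t in E) (K x t)%:E)%E.
Proof.
move=> mE mK K0.
have mi : measurable_fun [set: R] (\1_E : R -> R) by exact: measurable_indic.
pose G (z : R * R) := (K z.1 z.2 * \1_E z.2)%:E.
have mG : measurable_fun [set: R * R] G.
  apply/measurable_EFinP; apply: measurable_funM => //.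
  exact: (measurableT_comp mi measurable_snd).
under eq_fun => x do rewrite (integral_mk_indic _ mE).
apply: (measurable_fun_fubini_tonelli_F (m2 := mu) G) => //.
by move=> z; rewrite lee_fin mulr_ge0.
Qed.

(** Each inner [Rintegral] takes [fine], which would send an infinite integral to [0]; integrability
    of every section makes the inner values genuine. *)
Lemma Rintegral_Fubini (D E : set R) (K : R -> R -> R) :
  measurable D -> measurable E ->
  measurable_fun [set: R * R] (fun z => K z.1 z.2) ->
  (\int[mu]_(x in D) \int[mu]_(t in E) `|K x t|%:E < +oo)%E ->
  (forall x, D x -> mu.-integrable E (EFin \o K x)) ->
  (forall t, E t -> mu.-integrable D (EFin \o K^~ t)) ->
  Rintegral mu D (fun x => Rintegral mu E (K x)) =
  Rintegral mu E (fun t => Rintegral mu D (K^~ t)).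
Proof.
move=> mD mE mK iK iE iD.
(* Extending the kernel by zero outside [D x E] allows Fubini's theorem on the whole plane. *)
pose G (z : R * R) := (K z.1 z.2 * \1_D z.1 * \1_E z.2)%:E.
have mi (A : set R) : measurable A -> measurable_fun [set: R] (\1_A : R -> R).
  by move=> mA; exact: measurable_indic.
have mG : measurable_fun [set: R * R] G.
  apply/measurable_EFinP; apply: measurable_funM.
    apply: measurable_funM => //.
    exact: (measurableT_comp (mi _ mD) measurable_fst).
  exact: (measurableT_comp (mi _ mE) measurable_snd).
have iG : ((mu \x mu)%E).-integrable [set: R * R] G.
  apply/integrable12ltyP => //.
  apply: le_lt_trans iK.
  rewrite (integral_mk_indic _ mD) le_eqVlt; apply/orP; left; apply/eqP.
  apply: eq_integral => x _; rewrite (integral_mk_indic _ mE).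
  rewrite -ge0_integralZr//; last first.
    apply: emeasurable_funM; last by apply/measurable_EFinP; exact: mi.
    apply/measurable_EFinP; apply: measurableT_comp => //.
    exact: (measurableT_comp mK (pair1_measurable x)).
  apply: eq_integral => t _; rewrite /G /= !normrM -!EFinM.
  by rewrite !indicE !normr_nat mulrAC.
have E1 : (\int[mu]_(x in D) (Rintegral mu E (K x))%:E =
           \int[mu]_x \int[mu]_t G (x, t))%E.
  rewrite (integral_mk_indic _ mD); apply: eq_integral => x _.
  rewrite indicE; case: (boolP (x \in D)) => [/set_mem Dx|xD].
    rewrite mule1 /Rintegral fineK; last exact: integrable_fin_num (iE _ Dx).
    rewrite (integral_mk_indic _ mE); apply: eq_integral => t _.
    by rewrite /G /= [\1_D x]indicE mem_set// mulr1 EFinM.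
  rewrite mule0 -[LHS](integral0 mu setT); apply: eq_integral => t _.
  by rewrite /G /= [\1_D x]indicE (negbTE xD) mulr0 mul0r.
have E2 : (\int[mu]_(t in E) (Rintegral mu D (K^~ t))%:E =
           \int[mu]_t \int[mu]_x G (x, t))%E.
  rewrite (integral_mk_indic _ mE); apply: eq_integral => t _.
  rewrite indicE; case: (boolP (t \in E)) => [/set_mem Et|tE].
    rewrite mule1 /Rintegral fineK; last exact: integrable_fin_num (iD _ Et).
    rewrite (integral_mk_indic _ mD); apply: eq_integral => x _.
    by rewrite /G /= [\1_E t]indicE mem_set// mulr1 EFinM.
  rewrite mule0 -[LHS](integral0 mu setT); apply: eq_integral => x _.
  by rewrite /G /= [\1_E t]indicE (negbTE tE) mulr0.
by rewrite /Rintegral E1 E2 (Fubini iG).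
Qed.

End fubini.

(** * Functions with finite moments and exchange of integrals *)

Section finite_moments.
Context {R : realType}.
Local Notation mu := (@lebesgue_measure R).
Local Notation I := (`[0%R, 1%R]%classic : set R).

(** All powers are required, and not integrability alone, in order that the class be closed under
    products. *)
Definition finite_moments (f : R -> R) : Prop :=
  measurable_fun [set: R] f /\
  forall p : nat, mu.-integrable I (EFin \o (fun t => f t ^+ p)).

Lemma finite_moments_integrable f :
  finite_moments f -> mu.-integrable I (EFin \o f).
Proof. by move=> [_ /(_ 1%N)]. Qed.

Lemma finite_moments_bounded (f : R -> R) (M : R) :
  measurable_fun [set: R] f -> (forall x, `|f x| <= M) -> finite_moments f.
Proof.
move=> mf fM; split => // p.
apply: measurable_bounded_integrable => //.
- by rewrite /= lebesgue_measure_itv/= lte_fin ltr01/= ltry.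
- by apply: (@measurable_funS _ _ _ _ setT) => //; exact: measurable_funX.
- exists (M ^+ p); split; first exact: num_real.
  move=> y My x _ /=; rewrite normrX (le_trans _ (ltW My))//.
  by apply: lerXn2r; rewrite ?nnegrE// (le_trans _ (fM x)).
Qed.

Lemma finite_moments_cst (c : R) : finite_moments (cst c).
Proof. exact: (finite_moments_bounded (M := `|c|)). Qed.

(* [|fg|^p <= f^(2p) + g^(2p)] *)
Lemma finite_momentsM (f g : R -> R) :
  finite_moments f -> finite_moments g -> finite_moments (fun x => f x * g x).
Proof.
move=> [mf If] [mg Ig]; split=> [|p]; first exact: measurable_funM.
apply: (@le_integrable _ _ _ mu _ _ _
  (EFin \o (fun t => f t ^+ (2 * p) + g t ^+ (2 * p)))) => //.
- apply/measurable_EFinP; apply: (@measurable_funS _ _ _ _ setT) => //.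
  by apply: measurable_funX; exact: measurable_funM.
- move=> x _ /=; rewrite lee_fin.
  set a := f x; set b := g x.
  rewrite exprMn !(mulnC 2%N) !exprM.
  have := sqr_ge0 (`|a ^+ p| - `|b ^+ p|).
  have := sqr_ge0 (a ^+ p); have := sqr_ge0 (b ^+ p).
  rewrite normrM (ger0_norm (addr_ge0 (sqr_ge0 _) (sqr_ge0 _))).
  rewrite -(real_normK (num_real (a ^+ p))) -(real_normK (num_real (b ^+ p))).
  by nra.
- exact: (integrableD _ (If (2 * p)%N) (Ig (2 * p)%N)).
Qed.

Lemma finite_moments_prod (J : Type) (s : seq J) (Q : pred J) (f : J -> R -> R) :
  (forall j, finite_moments (f j)) ->
  finite_moments (fun x => \prod_(j <- s | Q j) f j x).
Proof.
move=> Hf; elim: s => [|j s IH].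
  by under eq_fun do rewrite big_nil; exact: finite_moments_cst.
under eq_fun do rewrite big_cons.
by case: (Q j) => //; exact: finite_momentsM.
Qed.

(** The uniform bound gives a double integral of [|P x * q x t|] of at most [C] times the integral
    of [|P|]. For fixed [t] the section in [x] is a product of two functions with finite moments. *)
Lemma Rintegral_swap (P : R -> R) (q : R -> R -> R) (C : R) :
  finite_moments P ->
  measurable_fun [set: R * R] (fun z => q z.1 z.2) ->
  (forall x, \int[mu]_(t in I) `|q x t|%:E <= C%:E)%E ->
  (forall t, finite_moments (q^~ t)) ->
  Rintegral mu I (fun t => Rintegral mu I (fun x => P x * q x t)) =
  Rintegral mu I (fun x => P x * Rintegral mu I (q x)).
Proof.
move=> fP mq qC fq.
have mqx x : measurable_fun [set: R] (q x).
  exact: (measurableT_comp mq (pair1_measurable x)).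
have iq x : mu.-integrable I (EFin \o q x).
  apply/integrableP; split.
    by apply/measurable_EFinP; exact: measurable_funS (mqx x).
  by apply: le_lt_trans (qC x) _; rewrite ltry.
have [mP _] := fP.
have C0 : 0 <= C.
  by rewrite -lee_fin; apply: le_trans (qC 0); apply: integral_ge0.
rewrite -(@Rintegral_Fubini _ I I (fun x t => P x * q x t))//.
- apply: eq_Rintegral => x _; rewrite RintegralZl//.
- by apply: measurable_funM => //; exact: (measurableT_comp mP measurable_fst).
- have /integrableP[_ iP] := finite_moments_integrable fP.
  apply: (@le_lt_trans _ _ (\int[mu]_(x in I) (`|P x|%:E * C%:E))%E); last first.
    rewrite ge0_integralZr//=; first by rewrite muleC lte_mul_pinfty.
    apply/measurable_EFinP; apply: measurableT_comp => //.
    exact: measurable_funS mP.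
  apply: ge0_le_integral => //.
  + by move=> x _; exact: integral_ge0.
  + apply: (@measurable_funS _ _ _ _ setT) => //.
    apply: measurable_integral_ge0 => //; apply: measurableT_comp => //.
    by apply: measurable_funM => //; exact: (measurableT_comp mP measurable_fst).
  + apply: emeasurable_funM => //; apply/measurable_EFinP.
    by apply: measurableT_comp => //; exact: measurable_funS mP.
  + move=> x _; under eq_integral do rewrite normrM EFinM.
    rewrite ge0_integralZl//; first by apply: lee_wpmul2l => //; exact: qC.
    apply/measurable_EFinP; apply: measurableT_comp => //.
    exact: measurable_funS (mqx x).
- by move=> x _; exact: (integrableZl _ (P x) (iq x)).
- by move=> t _; exact: finite_moments_integrable (finite_momentsM fP (fq t)).
Qed.

End finite_moments.

(** * Integrating out the variables one at a time *)

Section multiple_mahler_measure.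
Context {R : realType}.
Local Notation mu := (@lebesgue_measure R).
Local Notation I := (`[0%R, 1%R]%classic : set R).

Lemma lnabsp_ge0 (u v : R) : 0 <= lnabsp u v.
Proof. by rewrite /lnabsp le_max lexx. Qed.

Lemma lnabsp_le (u v : R) : lnabsp u v <= u ^+ 2 + v ^+ 2.
Proof.
rewrite /lnabsp /lnabs; have := addr_ge0 (sqr_ge0 u) (sqr_ge0 v).
set w := _ + _; rewrite le_eqVlt => /predU1P[<-|w0].
  by rewrite ln0// mul0r maxxx.
by rewrite ge_max ltW//=; have := ln_sublinear w0; lra.
Qed.

Lemma measurable_lnabsp d (T : measurableType d) (a b : T -> R) :
  measurable_fun [set: T] a -> measurable_fun [set: T] b ->
  measurable_fun [set: T] (fun t => lnabsp (a t) (b t)).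
Proof. by move=> ma mb; apply: measurable_maxr => //; exact: measurable_lnabs. Qed.

Definition ln_1xyz (x y z : R) : R :=
  lnabs (1 + cos2pi x + cos2pi y + cos2pi z) (sin2pi x + sin2pi y + sin2pi z).

(* Jensen's formula in [y]: the mean of [ln_1xyz x y z] *)
Definition lnp_1xz (x z : R) : R :=
  lnabsp (1 + cos2pi x + cos2pi z) (sin2pi x + sin2pi z).

Definition mahler_1xyz (x : R) : R := Rintegral mu I (lnp_1xz x).

Lemma ln_1xyzE x y z : ln_1xyz x y z =
  lnabs (1 + cos2pi x + cos2pi z + cos2pi y) (sin2pi x + sin2pi z + sin2pi y).
Proof. by rewrite /ln_1xyz addrAC [X in lnabs _ X]addrAC. Qed.

(** With [x] as the point moving on a circle and the rest as its centre, the moment bounds apply in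
    [x] for all [y] and [z]. *)
Lemma ln_1xyzE' x y z : ln_1xyz x y z =
  lnabs (1 + cos2pi y + cos2pi z + cos2pi x) (sin2pi y + sin2pi z + sin2pi x).
Proof. by rewrite /ln_1xyz; congr lnabs; ring. Qed.

Lemma Rintegral_ln_1xyz x z :
  Rintegral mu I (fun y => ln_1xyz x y z) = lnp_1xz x z.
Proof. by under eq_Rintegral do rewrite ln_1xyzE; exact: jensen. Qed.

Lemma cos2pi_bound (t : R) : -1 <= cos2pi t <= 1.
Proof. by rewrite /cos2pi cos_geN1 cos_le1. Qed.

Lemma sin2pi_bound (t : R) : -1 <= sin2pi t <= 1.
Proof. by rewrite /sin2pi sin_geN1 sin_le1. Qed.

(** The constant is [3^2 + 2^2], each cosine and sine being at most [1] in absolute value. *)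
Lemma sqr_1xz_le (x z : R) :
  (1 + cos2pi x + cos2pi z) ^+ 2 + (sin2pi x + sin2pi z) ^+ 2 <= 13.
Proof.
have := cos2pi_bound x; have := cos2pi_bound z.
have := sin2pi_bound x; have := sin2pi_bound z.
by nra.
Qed.

Lemma normr_lnp_1xz x z : `|lnp_1xz x z| <= 13.
Proof.
rewrite ger0_norm ?lnabsp_ge0//.
exact: le_trans (lnabsp_le _ _) (sqr_1xz_le x z).
Qed.

Lemma measurable_1xz d (T : measurableType d) (a b : T -> R) :
  measurable_fun [set: T] a -> measurable_fun [set: T] b ->
  measurable_fun [set: T] (fun t => lnp_1xz (a t) (b t)).
Proof.
move=> ma mb; apply: measurable_lnabsp.
- apply: measurable_funD; last exact: (measurableT_comp measurable_cos2pi mb).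
  by apply: measurable_funD => //; exact: (measurableT_comp measurable_cos2pi ma).
- apply: measurable_funD; last exact: (measurableT_comp measurable_sin2pi mb).
  exact: (measurableT_comp measurable_sin2pi ma).
Qed.

Lemma finite_moments_lnabs_circle u v :
  finite_moments (fun t => lnabs (u + cos2pi t) (v + sin2pi t) : R).
Proof.
split; first exact: measurable_lnabs_circle.
by move=> p; exact: integrable_lnabs_pow.
Qed.

Lemma finite_moments_ln_1xyz y z : finite_moments (fun x => ln_1xyz x y z).
Proof.
under eq_fun do rewrite ln_1xyzE'.
exact: finite_moments_lnabs_circle.
Qed.

Lemma finite_moments_lnp_1xz z : finite_moments (lnp_1xz^~ z).
Proof.
apply: (finite_moments_bounded (M := 13)); first exact: measurable_1xz.
by move=> x; exact: normr_lnp_1xz.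
Qed.

Lemma integrable_lnp_1xz x : mu.-integrable I (EFin \o lnp_1xz x).
Proof.
apply: finite_moments_integrable.
apply: (finite_moments_bounded (M := 13)); first exact: measurable_1xz.
by move=> z; exact: normr_lnp_1xz.
Qed.

Lemma integral_normr_lnp_1xz x :
  (\int[mu]_(z in I) `|lnp_1xz x z|%:E <= 13%:E)%E.
Proof.
apply: (@le_trans _ _ (\int[mu]_(z in I) (13%:E))%E).
  apply: ge0_le_integral => //.
  - apply/measurable_EFinP; apply: measurableT_comp => //.
    by apply: (@measurable_funS _ _ _ _ setT) => //; exact: measurable_1xz.
  - by move=> z _; rewrite lee_fin normr_lnp_1xz.
rewrite integral_cst//= lebesgue_measure_itv/= lte_fin ltr01/=.
by rewrite oppr0 adde0 mule1.
Qed.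

Lemma finite_moments_mahler_1xyz : finite_moments mahler_1xyz.
Proof.
apply: (finite_moments_bounded (M := 13)).
  apply: (measurableT_comp (f := fine)) => //.
  by apply: measurable_integral_ge0 => //;
    [exact: measurable_1xz|move=> x t; exact: lnabsp_ge0].
move=> x; rewrite /mahler_1xyz; apply: le_trans.
  exact: (le_normr_Rintegral _ (integrable_lnp_1xz x)).
rewrite -lee_fin fineK; first exact: integral_normr_lnp_1xz.
by apply: integrable_fin_num => //; exact/integrable_norm/integrable_lnp_1xz.
Qed.

Lemma integral_normr_ln_1xyz x z :
  (\int[mu]_(y in I) `|ln_1xyz x y z|%:E <= (lnabs_moment_bound 1 13)%:E)%E.
Proof.
under eq_integral do rewrite ln_1xyzE -[X in (X%:E)]expr1.
apply: (le_trans (integral_lnabs_pow 1 _ _)).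
rewrite lee_fin /lnabs_moment_bound !expr1 ler_pM2l// lerD2r ler_expR.
by have := sqr_1xz_le x z; lra.
Qed.

(* the integrand that remains once the variables of index [1, ..., m] have been
   integrated out, the variable [x] being kept for last *)
Definition factor (k m j : nat) (x : R) (e : nat -> R) : R :=
  if (m < j)%N then ln_1xyz x (e j) (e (k + j)%N)
  else if (m < k + j)%N then lnp_1xz x (e (k + j)%N)
  else mahler_1xyz x.

Lemma finite_moments_factor k m j e :
  finite_moments (fun x => factor k m j x e).
Proof.
rewrite /factor; case: (m < j)%N; first exact: finite_moments_ln_1xyz.
case: (m < k + j)%N; first exact: finite_moments_lnp_1xz.
exact: finite_moments_mahler_1xyz.
Qed.

Definition update (e : nat -> R) (n : nat) (t : R) : nat -> R :=
  fun i => if i == n then t else e i.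

Definition partial_integrand (k m : nat) (x : R) (e : nat -> R) : R :=
  \prod_(j <- iota 1 k) factor k m j x e.

(** Only one factor contains the variable of index [m + 1]. The others form [P], the exchange lemma
    moves the integral onto that one factor, and it is evaluated by Jensen's formula (a [y]
    variable) or by the definition of [mahler_1xyz] (a [z] variable). *)
Lemma integral_partial_integrand (k m : nat) (e : nat -> R) : (m < 2 * k)%N ->
  Rintegral mu I (fun t => Rintegral mu I
    (fun x => partial_integrand k m x (update e m.+1 t))) =
  Rintegral mu I (fun x => partial_integrand k m.+1 x e).
Proof.
(* The variable of index [m + 1] is [y_(m+1)] if [m < k] and [z_(m+1-k)] otherwise; [j0] is the
   index of its factor. *)
move=> mk; pose j0 := if (m < k)%N then m.+1 else (m.+1 - k)%N.
have j0k : j0 \in iota 1 k by rewrite mem_iota /j0; case: ifP => ?; lia.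
pose P x := \prod_(j <- iota 1 k | j != j0) factor k m.+1 j x e.
have other j x t : j \in iota 1 k -> j != j0 ->
    factor k m j x (update e m.+1 t) = factor k m.+1 j x e.
  rewrite mem_iota /j0 => jk.
  case: (ltnP m k) => mk' jj0; rewrite /factor /update.
    have -> : (j == m.+1) = false by exact: negbTE.
    have -> : (k + j == m.+1)%N = false by apply/negbTE; lia.
    have -> : (m.+1 < j)%N = (m < j)%N by apply/idP/idP; lia.
    by have -> : (m.+1 < k + j)%N = (m < k + j)%N by apply/idP/idP; lia.
  have -> : (m < j)%N = false by apply/negbTE; lia.
  have -> : (m.+1 < j)%N = false by apply/negbTE; lia.
  have -> : (k + j == m.+1)%N = false by apply/negbTE; lia.
  by have -> : (m.+1 < k + j)%N = (m < k + j)%N by apply/idP/idP; lia.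
pose q x t := factor k m j0 x (update e m.+1 t).
have partialE x t : partial_integrand k m x (update e m.+1 t) = P x * q x t.
  rewrite /partial_integrand (bigD1_seq j0) ?iota_uniq//= mulrC; congr (_ * _).
  rewrite big_seq_cond [RHS]big_seq_cond; apply: eq_bigr => j /andP[jk jj0].
  exact: other.
have partialSE x : partial_integrand k m.+1 x e = P x * factor k m.+1 j0 x e.
  by rewrite /partial_integrand (bigD1_seq j0) ?iota_uniq//= mulrC.
have fP : finite_moments P.
  by apply: finite_moments_prod => j; exact: finite_moments_factor.
have fq t : finite_moments (q^~ t) by exact: finite_moments_factor.
(* The bound [C] is the first moment bound at squared radius [13] when a [y] is integrated, and the
   sup bound [13] when a [z] is. *)
have [C [mq qC qE]] : exists C,
  [/\ measurable_fun [set: R * R] (fun z => q z.1 z.2),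
    (forall x, \int[mu]_(t in I) `|q x t|%:E <= C%:E)%E &
    forall x, Rintegral mu I (q x) = factor k m.+1 j0 x e].
  rewrite /q /factor /j0; case: (ltnP m k) => mk'.
    have -> : (m < m.+1)%N by [].
    have -> : (m.+1 < m.+1)%N = false by rewrite ltnn.
    have -> : (m.+1 < k + m.+1)%N by lia.
    set z := e (k + m.+1)%N.
    have E x t : ln_1xyz x (update e m.+1 t m.+1)
        (update e m.+1 t (k + m.+1)%N) = ln_1xyz x t z.
      rewrite /update eqxx; have -> // : (k + m.+1 == m.+1)%N = false.
      by apply/negbTE; lia.
    exists (lnabs_moment_bound 1 13); split.
    - under eq_fun do rewrite E.
      apply: measurable_lnabs.
        apply: measurable_funD => //; apply: measurable_funD; last first.
          exact: (measurableT_comp measurable_cos2pi measurable_snd).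
        apply: measurable_funD => //.
        exact: (measurableT_comp measurable_cos2pi measurable_fst).
      apply: measurable_funD => //; apply: measurable_funD.
        exact: (measurableT_comp measurable_sin2pi measurable_fst).
      exact: (measurableT_comp measurable_sin2pi measurable_snd).
    - by move=> x; under eq_integral do rewrite E; exact: integral_normr_ln_1xyz.
    - by move=> x; under eq_Rintegral do rewrite E; exact: Rintegral_ln_1xyz.
  have -> : (m < m.+1 - k)%N = false by apply/negbTE; lia.
  have -> : (m.+1 < m.+1 - k)%N = false by apply/negbTE; lia.
  have -> : (k + (m.+1 - k) = m.+1)%N by lia.
  rewrite ltnSn ltnn.
  have E x t : lnp_1xz x (update e m.+1 t m.+1) = lnp_1xz x t.
    by rewrite /update eqxx.
  exists 13; split.
  - by under eq_fun do rewrite E; exact: measurable_1xz.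
  - by move=> x; under eq_integral do rewrite E; exact: integral_normr_lnp_1xz.
  - by move=> x; under eq_Rintegral do rewrite E.
transitivity (Rintegral mu I (fun t => Rintegral mu I (fun x => P x * q x t))).
  by apply: eq_Rintegral => t _; apply: eq_Rintegral => x _; exact: partialE.
rewrite (Rintegral_swap fP mq qC fq).
by apply: eq_Rintegral => x _; rewrite qE partialSE.
Qed.

Definition full_integrand (k : nat) (v : nat -> R) : R :=
  \prod_(j <- iota 1 k) ln_1xyz (v 0%N) (v j) (v (k + j)%N).

Lemma iter_intS (n : nat) (F : (nat -> R) -> R) : iter_int n.+1 F =
  Rintegral mu I
    (fun t => iter_int n (fun v => F (fun i => if i == n then t else v i))).
Proof. by []. Qed.

(** The environment [e] holds the variables of index above [m]. The outermost integral of
    [iter_int m.+2] runs over the variable of index [m + 1]: for each of its values the induction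
    hypothesis is used in the updated environment. At [m = 0] only the integral over [x] is left. *)
Lemma iter_int_partial_integrand (k m : nat) (e : nat -> R) : (m <= 2 * k)%N ->
  iter_int m.+1
    (fun v => full_integrand k (fun i => if (i < m.+1)%N then v i else e i)) =
  Rintegral mu I (fun x => partial_integrand k m x e).
Proof.
elim: m e => [|m IH] e mk.
  apply: eq_Rintegral => x _; rewrite /= /full_integrand /partial_integrand.
  apply: eq_big_seq => j; rewrite mem_iota => jk; rewrite /factor /=.
  have -> : (0 < j)%N by lia.
  have -> : (j < 1)%N = false by apply/negbTE; lia.
  by have -> : (k + j < 1)%N = false by apply/negbTE; lia.
rewrite -(integral_partial_integrand e mk) iter_intS.
apply: eq_Rintegral => t _; rewrite -(IH _ (ltnW mk)).
congr iter_int; apply/funext => v; congr full_integrand; apply/funext => i.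
rewrite /update [in LHS]ltnS [in LHS]leq_eqVlt orbC.
by have [->|im] := eqVneq i m.+1; rewrite ?ltnn// orbF.
Qed.

Lemma multi_mahler_1xyz (k : nat) :
  multi_mahler (2 * k).+1 [seq @P1xyz R k j | j <- iota 1 k] =
  Rintegral mu I (fun x => mahler_1xyz x ^+ k).
Proof.
transitivity (iter_int (2 * k).+1 (fun v => full_integrand k
    (fun i => if (i < (2 * k).+1)%N then v i else 0))).
  rewrite /multi_mahler; congr (iter_int _ _); apply/funext => v.
  rewrite big_map; apply: eq_big_seq => j; rewrite mem_iota => jk; rewrite ltn0Sn.
  have -> : (j < (2 * k).+1)%N by lia.
  have -> : (k + j < (2 * k).+1)%N by lia.
  rewrite /ln_1xyz -ln_normc; congr (ln (Normc.normc _)).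
  by rewrite /P1xyz /expi2pi; simpc.
rewrite iter_int_partial_integrand//; apply: eq_Rintegral => x _.
(* At [m = 2 k] all the [y] and [z] are gone, and each of the [k] factors is [mahler_1xyz x]. *)
transitivity (\prod_(1 <= j < k.+1) mahler_1xyz x); last first.
  by rewrite prodr_const_nat subSS subn0.
rewrite /partial_integrand /index_iota subSS subn0.
apply: eq_big_seq => j; rewrite mem_iota => jk; rewrite /factor.
have -> : (2 * k < j)%N = false by apply/negbTE; lia.
by have -> : (2 * k < k + j)%N = false by apply/negbTE; lia.
Qed.

End multiple_mahler_measure.
(** * The mean of log+ |r + e^{it}| *)

Section circle_mean_lnp.
Context {R : realType}.
Local Notation mu := (@lebesgue_measure R).
Local Notation I := (`[0%R, 1%R]%classic : set R).

Lemma fine_EFinM (c : R) (x : \bar R) : 0 < c -> fine (c%:E * x)%E = c * fine x.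
Proof.
rewrite -lte_fin => c0; case: x => [x| |] //=; rewrite ?mulr0.
- by rewrite gt0_muley.
- by rewrite gt0_muleNy.
Qed.

Definition lnp_circle (r c : R) : R := Num.max 0 (ln_circle r c).

(** The quantity [W] as a function of the radius. *)
Definition half_circle_lnp (r : R) : R :=
  Rintegral mu `[0, pi] (fun phi => lnp_circle r (cos phi)).

Lemma lnp_circle_ge0 r c : 0 <= lnp_circle r c.
Proof. by rewrite /lnp_circle le_max lexx. Qed.

Lemma measurable_lnp_circle d (T : measurableType d) (a b : T -> R) :
  measurable_fun [set: T] a -> measurable_fun [set: T] b ->
  measurable_fun [set: T] (fun t => lnp_circle (a t) (b t)).
Proof.
move=> ma mb; apply: measurable_maxr => //; apply: measurable_funM => //.
apply: (measurableT_comp (@measurable_ln R)); apply: measurable_funD => //.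
apply: measurable_funD; first exact: measurable_funX.
by apply: measurable_funM => //; exact: measurable_funM.
Qed.

Lemma measurable_half_circle_lnp : measurable_fun [set: R] half_circle_lnp.
Proof.
apply: (measurableT_comp (f := fine)) => //.
apply: (@measurable_integral_ge0 _ _ (fun r phi => lnp_circle r (cos phi))) => //.
  apply: measurable_lnp_circle; first exact: measurable_fst.
  exact: (measurableT_comp measurable_cos measurable_snd).
by move=> r phi; exact: lnp_circle_ge0.
Qed.

Lemma half_circle_lnp_ge0 r : 0 <= half_circle_lnp r.
Proof. by apply: Rintegral_ge0 => phi _; exact: lnp_circle_ge0. Qed.

Lemma Rintegral_lnp_circle (r : R) :
  Rintegral mu I (fun t => lnp_circle r (cos2pi t)) = pi^-1 * half_circle_lnp r.
Proof.
rewrite /Rintegral (@integral_cos2pi _ (fun c => (lnp_circle r c)%:E)).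
  by rewrite fine_EFinM// invr_gt0 pi_gt0.
by apply/measurable_EFinP; exact: measurable_lnp_circle.
Qed.

(** The radius is [|1 + e^{2 pi i x}|]. It is written through [cos2pi x] alone, the form that lets
    the mean over [x] pass to the half circle. *)
Lemma mahler_1xyzE (x : R) :
  mahler_1xyz x = pi^-1 * half_circle_lnp (Num.sqrt (2 + 2 * cos2pi x)).
Proof.
rewrite -Rintegral_lnp_circle /mahler_1xyz /Rintegral /lnp_1xz /lnabsp /lnabs.
rewrite (@integral_circle _ (fun w => (Num.max 0 (ln w / 2))%:E)); last first.
  apply/measurable_EFinP; apply: measurable_maxr => //.
  by apply: measurable_funM => //; exact: measurable_ln.
have -> : (1 + cos2pi x) ^+ 2 + sin2pi x ^+ 2 = 2 + 2 * cos2pi x.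
  have := cos2Dsin2 (2 * pi * x); rewrite -/(cos2pi x) -/(sin2pi x) => h.
  by rewrite sqrrD; lra.
congr fine; apply: eq_integral => t _; rewrite /lnp_circle /ln_circle.
rewrite sqr_sqrtr//; have := cos2pi_bound x; lra.
Qed.

Lemma Rintegral_mahler_1xyz_pow (k : nat) :
  Rintegral mu I (fun x => mahler_1xyz x ^+ k) =
  (pi ^+ k.+1)^-1 *
    Rintegral mu `[0, pi]
      (fun theta => half_circle_lnp (2 * sin (theta / 2)) ^+ k).
Proof.
under eq_Rintegral do rewrite mahler_1xyzE exprMn exprVn.
pose h (c : R) : \bar R :=
  ((pi ^+ k)^-1 * half_circle_lnp (Num.sqrt (2 + 2 * c)) ^+ k)%:E.
have mh : measurable_fun [set: R] h.
  apply/measurable_EFinP; apply: measurable_funM => //; apply: measurable_funX.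
  apply: (measurableT_comp measurable_half_circle_lnp).
  apply: (measurableT_comp measurable_sqrt).
  by apply: measurable_funD => //; exact: measurable_funM.
have pk0 : 0 < (pi ^+ k)^-1 :> R by rewrite invr_gt0 exprn_gt0// pi_gt0.
rewrite /Rintegral (integral_cos2pi mh) fine_EFinM ?invr_gt0 ?pi_gt0//.
(* Under [x = pi - theta] the radius [sqrt (2 + 2 cos x)] becomes [sqrt (2 - 2 cos theta) = 2 sin
   (theta / 2)]. *)
rewrite -integral_reflect; last exact: (measurableT_comp mh measurable_cos).
rewrite exprS invfM -mulrA -(fine_EFinM _ pk0); congr (_ * fine _).
rewrite -ge0_integralZl_EFin; last 4 first.
- exact: measurable_itv.
- by move=> x _; rewrite lee_fin exprn_ge0// half_circle_lnp_ge0.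
- apply/measurable_EFinP; apply: (@measurable_funS _ _ _ _ setT) => //.
  apply: measurable_funX; apply: (measurableT_comp measurable_half_circle_lnp).
  apply: measurable_funM => //; apply: (measurableT_comp measurable_sin).
  exact: measurable_funM.
- exact: ltW.
apply: eq_integral => t; rewrite inE/= in_itv/= => /andP[t0 tp].
rewrite /h EFinM; congr (_ * (half_circle_lnp _ ^+ k)%:E)%E.
have s0 : 0 <= sin (t / 2) by apply: sin_ge0_pi; lra.
rewrite -[RHS]ger0_norm ?mulr_ge0// -sqrtr_sqr; congr Num.sqrt.
rewrite cosB cospi sinpi mul0r addr0 mulN1r.
rewrite [in LHS](_ : t = (t / 2) *+ 2); last by rewrite -mulr_natr mulfVK.
rewrite cos_mulr2n -(mulr_natr (_ ^+ 2)) exprMn sin2cos2; ring.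
Qed.

Lemma half_circle_lnp2 : half_circle_lnp 2 = pi * ln 2.
Proof.
have p0 : pi != 0 :> R by rewrite gt_eqF// pi_gt0.
apply: (mulfI (invr_neq0 p0)); rewrite -Rintegral_lnp_circle mulKf//.
rewrite -(@mean_ln_circle_gt1 _ 2) ?ltr1n//.
apply: eq_Rintegral => t _; rewrite /lnp_circle max_r// /ln_circle divr_ge0//.
by apply: ln_ge0; have := cos2pi_bound t; lra.
Qed.

Lemma half_circle_lnp0 : half_circle_lnp 0 = 0.
Proof.
rewrite /half_circle_lnp (@eq_Rintegral _ _ _ mu _ (cst 0)); last first.
  move=> t _; rewrite /lnp_circle /ln_circle expr0n/= mulr0 mul0r !add0r ln1 mul0r.
  by rewrite maxxx.
by rewrite /Rintegral integral0.
Qed.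

Lemma Rintegral_Fubini_bounded (D E : set R) (K : R -> R -> R) (M : R) :
  measurable D -> measurable E -> (mu D < +oo)%E -> (mu E < +oo)%E ->
  measurable_fun [set: R * R] (fun z => K z.1 z.2) ->
  (forall x t, D x -> E t -> `|K x t| <= M) ->
  Rintegral mu D (fun x => Rintegral mu E (K x)) =
  Rintegral mu E (fun t => Rintegral mu D (K^~ t)).
Proof.
move=> mD mE Dfin Efin mK KM; apply: Rintegral_Fubini => //.
- apply: (@le_lt_trans _ _ (\int[mu]_(x in D) \int[mu]_(t in E) M%:E)%E).
    apply: ge0_le_integral => //.
    + by move=> x _; exact: integral_ge0.
    + apply: (@measurable_funS _ _ _ _ setT) => //.
      by apply: measurable_integral_ge0 => //; exact: measurableT_comp.
    + move=> x Dx; apply: ge0_le_integral => //.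
      * apply/measurable_EFinP; apply: measurableT_comp => //.
        apply: (@measurable_funS _ _ _ _ setT) => //.
        exact: (measurableT_comp mK (pair1_measurable x)).
      * by move=> t Et; rewrite lee_fin KM.
  under eq_integral do rewrite integral_cst//.
  rewrite integral_cst//= ltey_eq !fin_numM//.
    by rewrite ge0_fin_numE.
  by rewrite ge0_fin_numE.
- move=> x Dx; apply: measurable_bounded_integrable => //.
    apply: (@measurable_funS _ _ _ _ setT) => //.
    exact: (measurableT_comp mK (pair1_measurable x)).
  exists M; split; first exact: num_real.
  by move=> y My t Et /=; rewrite (le_trans (KM _ _ Dx Et))// ltW.
- move=> t Et; apply: measurable_bounded_integrable => //.
    apply: (@measurable_funS _ _ _ _ setT) => //.
    exact: (measurableT_comp mK (pair2_measurable t)).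
  exists M; split; first exact: num_real.
  by move=> y My x Dx /=; rewrite (le_trans (KM _ _ Dx Et))// ltW.
Qed.

End circle_mean_lnp.
(** * The Clausen function *)

Section clausen.
Context {R : realType}.
Local Notation mu := (@lebesgue_measure R).

Lemma is_derive_sum_nat (f df : nat -> R -> R) (x : R) (N : nat) :
  (forall n, is_derive x 1 (f n) (df n x)) ->
  is_derive x 1 (fun s => \sum_(0 <= n < N) f n s) (\sum_(0 <= n < N) df n x).
Proof.
move=> H; elim: N => [|N IH].
  under eq_fun do rewrite big_nil; rewrite big_nil.
  exact: is_derive_cst.
under eq_fun do rewrite big_nat_recr//=; rewrite big_nat_recr//=.
exact: is_deriveD.
Qed.

Lemma is_derive_scale (k : R) (f : R -> R) (x df : R) : is_derive x 1 f df ->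
  is_derive x 1 (fun s => k * f s) (k * df).
Proof. by move=> H; exact: (is_deriveZ k). Qed.

Lemma is_derive_mulr (k x : R) : is_derive x 1 (fun s : R => k * s) k.
Proof. by rewrite -[X in is_derive _ _ _ X]mulr1; apply: is_derive_scale. Qed.

Lemma is_derive_pow (n : nat) (x : R) :
  is_derive x 1 (fun s : R => s ^+ n.+1) (n.+1%:R * x ^+ n).
Proof.
have := is_deriveX n.+1 (is_derive_id x (1 : R)).
by rewrite /GRing.scale/= mulr1 exprfctE.
Qed.

(** With [z = s e^{it}], this is a partial sum of the series [sum Re (z^n) / n] of
    [- ln |1 - z|]. *)
Definition cos_psum (t s : R) (N : nat) : R :=
  \sum_(0 <= n < N) s ^+ n.+1 * cos (n.+1%:R * t) / n.+1%:R.

(* [|1 - s e^{it}|^2] *)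
Definition poisson_denom (t s : R) : R := 1 - 2 * s * cos t + s ^+ 2.

(** This is the real part of a finite geometric sum with its denominator cleared; the induction uses
    the three-term recurrence of [cos (n t)]. *)
Lemma geometric_cos_sum (t s : R) (N : nat) :
  poisson_denom t s * (\sum_(0 <= n < N) s ^+ n * cos (n.+1%:R * t)) =
  cos t - s - s ^+ N * cos (N.+1%:R * t) + s ^+ N.+1 * cos (N%:R * t).
Proof.
elim: N => [|N IH].
  by rewrite big_nil mulr0 !mul0r expr0 !mul1r cos0; ring.
rewrite big_nat_recr//= mulrDr IH /poisson_denom.
have -> : cos (N.+2%:R * t) = 2 * cos t * cos (N.+1%:R * t) - cos (N%:R * t).
  have -> : N.+2%:R * t = N.+1%:R * t + t by rewrite -[N.+2%:R]natr1; ring.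
  have -> : N%:R * t = N.+1%:R * t - t by rewrite -[N.+1%:R]natr1; ring.
  by rewrite cosD cosB; ring.
rewrite !exprS; ring.
Qed.

Lemma cos_half (t : R) : cos t = 1 - 2 * sin (t / 2) ^+ 2.
Proof.
rewrite [in LHS](_ : t = (t / 2) *+ 2); last by rewrite -mulr_natr mulfVK.
by rewrite cos_mulr2n -(mulr_natr (_ ^+ 2)) cos2sin2; ring.
Qed.

Lemma poisson_denom_ge (t s : R) : 0 <= s <= 1 ->
  sin (t / 2) ^+ 2 <= poisson_denom t s.
Proof.
move=> /andP[s0 s1]; rewrite /poisson_denom cos_half.
have h0 := sqr_ge0 (sin (t / 2)).
have h1 : sin (t / 2) ^+ 2 <= 1 by rewrite sin2cos2 gerBl sqr_ge0.
move: h0 h1; set g := sin (t / 2) ^+ 2 => h0 h1.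
have h2 := sqr_ge0 (1 - s).
(* The denominator is [(1 - s)^2 + 4 s g], hence at least
   [g ((1 - s)^2 + 4 s) = g (1 + s (s + 2))]. *)
have : g * (1 - s) ^+ 2 <= (1 - s) ^+ 2 by rewrite ler_piMl.
have : 0 <= g * (s * (s + 2)).
  by apply: mulr_ge0 => //; apply: mulr_ge0 => //; lra.
by nra.
Qed.

(* In [s], the function [cos_psum t s N + ln (poisson_denom t s) / 2] vanishes at
   [0] and its derivative is dominated by that of
   [2 s^(N+1) / ((N+1) sin^2 (t/2))]. *)
Lemma cos_psum_approx (t : R) (N : nat) : 0 < sin (t / 2) ->
  `|cos_psum t 1 N + ln (2 * sin (t / 2))| <=
  2 / (N.+1%:R * sin (t / 2) ^+ 2).
Proof.
move=> st; set d := sin (t / 2) ^+ 2.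
have d0 : 0 < d by rewrite exprn_gt0.
pose u s := cos_psum t s N + ln (poisson_denom t s) / 2.
(* This is the derivative of [u]: in [geometric_cos_sum] the term [cos t - s] cancels against the
   derivative of the logarithm. *)
pose r (s : R) :=
  (- (s ^+ N * cos (N.+1%:R * t)) + s ^+ N.+1 * cos (N%:R * t)) /
  poisson_denom t s.
have den0 (s : R) : 0 <= s <= 1 -> 0 < poisson_denom t s.
  by move=> /(poisson_denom_ge t); exact: lt_le_trans.
have du (s : R) : 0 <= s <= 1 -> is_derive s 1 u (r s).
  move=> s01; have D0 := den0 _ s01.
  have d1 : is_derive s 1 (fun s => cos_psum t s N)
      (\sum_(0 <= n < N) s ^+ n * cos (n.+1%:R * t)).
    apply: (is_derive_sum_nat (df := fun n s => s ^+ n * cos (n.+1%:R * t))) => n.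
    have := is_derive_scale (cos (n.+1%:R * t) / n.+1%:R) (is_derive_pow n s).
    rewrite (_ : (fun _ => _) =
      fun x => x ^+ n.+1 * cos (n.+1%:R * t) / n.+1%:R); last first.
      by apply/funext => x; rewrite mulrC mulrA.
    by move/is_derive_eq; apply; field; rewrite addrC natr1 pnatr_eq0.
  have d2 : is_derive s 1 (poisson_denom t) (2 * s - 2 * cos t).
    have e1 := is_derive_mulr (- 2 * cos t) s.
    have e2 := is_derive_pow 1 s.
    have := is_deriveD (is_deriveD (is_derive_cst (1 : R) s (1:R)) e1) e2.
    rewrite (_ : _ + _ = poisson_denom t); last first.
      apply/funext => x; rewrite -[LHS]/(1 + - 2 * cos t * x + x ^+ 2).
      by rewrite /poisson_denom; ring.
    by move/is_derive_eq; apply; rewrite expr1; ring.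
  have d3 := is_derive1_comp (is_derive1_ln D0) d2.
  have := is_deriveD d1 (is_derive_scale 2^-1 d3).
  rewrite (_ : _ + _ = u); last first.
    by apply/funext => x; rewrite /u /= [X in _ + X = _]mulrC.
  move/is_derive_eq; apply.
  have Dn0 : poisson_denom t s != 0 by rewrite gt_eqF.
  have -> : \sum_(0 <= n < N) s ^+ n * cos (n.+1%:R * t) =
      (cos t - s - s ^+ N * cos (N.+1%:R * t) + s ^+ N.+1 * cos (N%:R * t)) /
      poisson_denom t s.
    by rewrite -geometric_cos_sum mulrC mulKf.
  by rewrite /r; field.
have rb (s : R) : 0 <= s <= 1 -> `|r s| <= 2 / d * s ^+ N.
  move=> s01; have D0 := den0 _ s01; case/andP: (s01) => s0 s1.
  rewrite /r normrM normfV (gtr0_norm D0) ler_pdivrMr//.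
  apply: (@le_trans _ _ (2 * s ^+ N)).
    apply: (le_trans (ler_normD _ _)).
    rewrite normrN !normrM !(ger0_norm (exprn_ge0 _ s0)).
    have := cos_max (N.+1%:R * t); have := cos_max (N%:R * t).
    have sN : 0 <= s ^+ N by exact: exprn_ge0.
    have sN1 : s ^+ N.+1 <= s ^+ N by rewrite exprS ler_piMl.
    have sN2 : 0 <= s ^+ N.+1 by exact: exprn_ge0.
    move=> c1 c2.
    have := ler_piMr sN c2; have := ler_piMr sN2 c1; lra.
  have -> : 2 / d * s ^+ N * poisson_denom t s =
      2 * s ^+ N * (poisson_denom t s / d) by ring.
  rewrite ler_peMr ?mulr_ge0 ?exprn_ge0// ler_pdivlMr// mul1r.
  exact: poisson_denom_ge.
pose v (s : R) := 2 / d / N.+1%:R * s ^+ N.+1.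
have dv (s : R) : is_derive s 1 v (2 / d * s ^+ N).
  have := is_derive_scale (2 / d / N.+1%:R) (is_derive_pow N s).
  move/is_derive_eq; apply; field.
  by rewrite addrC natr1 pnatr_eq0/= gt_eqF.
(* The signs [e = 1] and [e = -1] give the two halves of the absolute value. The mean value theorem
   is applied to [v - e u], which vanishes at [0] and has nonnegative derivative by [rb]. *)
have key (e : R) : `|e| = 1 -> e * u 1 <= v 1.
  move=> e1.
  have dw (s : R) : s \in `]0, 1[ ->
      is_derive s 1 (v - e *: u) (2 / d * s ^+ N - e * r s).
    rewrite in_itv/= => /andP[s0 s1].
    apply: is_deriveB; apply: is_derive_scale; apply: du.
    by rewrite !ltW.
  have cw : {within `[0, 1]%classic, continuous (v - e *: u)}.
    apply: segment_continuous_within => s; rewrite in_itv/= => s01.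
    have := is_deriveB (dv s) (is_derive_scale e (du _ s01)).
    exact: is_derive_continuous.
  have [c c01] := MVT ltr01 dw cw.
  have u0 : u 0 = 0.
    rewrite /u /cos_psum /poisson_denom big1 => [|i _].
      by rewrite mulr0 mul0r subr0 expr0n/= addr0 ln1 mul0r addr0.
    by rewrite exprS !mul0r.
  have v0 : v 0 = 0 by rewrite /v exprS mul0r mulr0.
  rewrite -[_ 1]/(v 1 - e * u 1) -[_ 0]/(v 0 - e * u 0) u0 v0 mulr0 !subr0 mulr1.
  move=> E; rewrite -subr_ge0 E subr_ge0.
  have c01' : 0 <= c <= 1 by move: c01; rewrite in_itv/= => /andP[/ltW -> /ltW ->].
  apply: le_trans (rb _ c01').
  by rewrite (le_trans (ler_norm _))// normrM e1 mul1r.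
have u1 : u 1 = cos_psum t 1 N + ln (2 * sin (t / 2)).
  rewrite /u /poisson_denom cos_half; congr (_ + _).
  have -> : 1 - 2 * 1 * (1 - 2 * sin (t / 2) ^+ 2) + 1 ^+ 2 =
      (2 * sin (t / 2)) ^+ 2.
    by ring.
  by rewrite lnXn ?mulr_gt0// -(mulr_natr (ln _)) mulfK.
have v1 : v 1 = 2 / (N.+1%:R * d).
  by rewrite /v expr1n mulr1 -[LHS]mulrA -[in LHS]invfM (mulrC d).
rewrite -u1 -v1 ler_norml; apply/andP; split.
  by have := key (-1); rewrite normrN1 mulN1r lerNl => /(_ erefl).
by have := key 1; rewrite normr1 mul1r => /(_ erefl).
Qed.

End clausen.

(** * The Clausen function as an integral of the log sine *)

Section clausen_integral.
Context {R : realType}.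
Local Notation mu := (@lebesgue_measure R).

Lemma sin_half_ge (theta t : R) : 0 < theta -> t \in `[theta, pi] ->
  theta / 8 <= sin (t / 2).
Proof.
rewrite in_itv/= => th0 /andP[tht tp].
have := @sin_ge_quarter _ (t / 2); have p0 := @pi_gt0 R.
by move=> /(_ ltac:(lra)); lra.
Qed.

Lemma sin_half_gt0 (theta t : R) : 0 < theta -> t \in `[theta, pi] ->
  0 < sin (t / 2).
Proof. by move=> th0 /(sin_half_ge th0); apply: lt_le_trans; rewrite divr_gt0. Qed.

Lemma is_derive_sin_half (t : R) :
  is_derive t 1 (fun s : R => sin (s / 2)) (cos (t / 2) / 2).
Proof.
have h : is_derive t 1 (fun s : R => s / 2) 2^-1.
  by under eq_fun do rewrite mulrC; exact: is_derive_mulr.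
exact: (@is_derive1_comp _ sin (fun s => s / 2) t _ _ (is_derive_sin (t / 2)) h).
Qed.

Lemma is_derive_cos_half (t : R) :
  is_derive t 1 (fun s : R => cos (s / 2)) (- sin (t / 2) / 2).
Proof.
have h : is_derive t 1 (fun s : R => s / 2) 2^-1.
  by under eq_fun do rewrite mulrC; exact: is_derive_mulr.
exact: (@is_derive1_comp _ cos (fun s => s / 2) t _ _ (is_derive_cos (t / 2)) h).
Qed.

Lemma is_derive_ln_sin_half (t : R) : 0 < sin (t / 2) ->
  is_derive t 1 (fun s : R => ln (2 * sin (s / 2)))
    (cos (t / 2) / sin (t / 2) / 2).
Proof.
move=> s0; have h := is_derive_scale 2 (is_derive_sin_half t).
have s20 : 0 < 2 * sin (t / 2) by rewrite mulr_gt0.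
have := @is_derive1_comp _ (@ln R) (fun s => 2 * sin (s / 2)) t _ _
  (is_derive1_ln s20) h.
by move/is_derive_eq; apply; field; rewrite gt_eqF.
Qed.

Lemma is_derive_sin_mulr (k t : R) :
  is_derive t 1 (fun s : R => sin (k * s)) (k * cos (k * t)).
Proof.
have := @is_derive1_comp _ sin (fun s => k * s) t _ _
  (is_derive_sin (k * t)) (is_derive_mulr k t).
by move/is_derive_eq; apply; rewrite mulrC.
Qed.

Definition half_cot (t : R) : R := t / 2 * (cos (t / 2) / sin (t / 2)).

(** The integral form of the Clausen function, taken from [theta] up to [pi] so as to stay away from
    the singularity at [0]. *)
Definition ln_sin_integral (theta : R) : R :=
  Rintegral mu `[theta, pi] (fun t => ln (2 * sin (t / 2))).

Section fixed_angle.
Variable theta : R.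
Hypotheses (th0 : 0 < theta) (thpi : theta <= pi).

Let sin_half (t : R) : t \in `[theta, pi] -> 0 < sin (t / 2).
Proof. exact: sin_half_gt0. Qed.

Let cont_ln : {in `[theta, pi], forall t : R,
  {for t, continuous (fun s : R => ln (2 * sin (s / 2)))}}.
Proof.
by move=> t /sin_half st; exact: is_derive_continuous (is_derive_ln_sin_half st).
Qed.

Lemma continuous_half_cot : {in `[theta, pi], forall t : R,
  {for t, continuous half_cot}}.
Proof.
move=> t /sin_half st; apply: continuousM.
  by apply: continuousM; [exact: cvg_id|exact: cvg_cst].
apply: continuousM; first exact: is_derive_continuous (is_derive_cos_half t).
apply: continuousV; first by rewrite gt_eqF.
exact: is_derive_continuous (is_derive_sin_half t).
Qed.

Let integrable_cont (f : R -> R) :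
  {in `[theta, pi], forall t : R, {for t, continuous f}} ->
  mu.-integrable `[theta, pi] (EFin \o f).
Proof.
move=> cf; apply: continuous_compact_integrable; first exact: segment_compact.
exact: segment_continuous_within.
Qed.

(* [ln (2 sin (t/2)) + half_cot t] is the derivative of [t ln (2 sin (t/2))]. *)
Lemma ln_sin_integralE :
  ln_sin_integral theta =
  pi * ln 2 - theta * ln (2 * sin (theta / 2)) -
  Rintegral mu `[theta, pi] half_cot.
Proof.
rewrite /ln_sin_integral; apply/eqP; rewrite -subr_eq opprK addrC; apply/eqP.
rewrite addrC -RintegralD//; last 2 first.
- exact: integrable_cont.
- exact/integrable_cont/continuous_half_cot.
rewrite /Rintegral.
rewrite (integral_is_derive (F := fun t => t * ln (2 * sin (t / 2))))//=.
- by rewrite sin_pihalf mulr1.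
- move=> t /sin_half st.
  have := is_deriveM (is_derive_id t (1:R)) (is_derive_ln_sin_half st).
  move/is_derive_eq; apply; rewrite /GRing.scale/= mulr1 addrC /half_cot; ring.
- move=> t tp; apply: continuousD; first exact: cont_ln.
  exact: continuous_half_cot.
Qed.

Let cl2_term (n : nat) (t : R) : R := sin (n.+1%:R * t) / n.+1%:R ^+ 2.

Let sin_natpi (n : nat) : sin (n%:R * pi) = 0 :> R.
Proof.
elim: n => [|n IH]; first by rewrite mul0r sin0.
by rewrite -natr1 mulrDl mul1r sinDpi IH oppr0.
Qed.

(** All sine terms vanish at [pi], so the partial sum is minus the integral of [cos_psum] over
    [[theta, pi]]. There [cos_psum] is close to [- ln (2 sin (t/2))], uniformly because
    [sin (t/2) >= theta / 8], and the interval has length at most [pi]. *)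
Lemma clausen_psum_approx (N : nat) :
  `|\sum_(0 <= n < N) cl2_term n theta - ln_sin_integral theta| <=
  pi * (2 / (theta / 8) ^+ 2) / N.+1%:R.
Proof.
have dS (t : R) :
    is_derive t 1 (fun s => \sum_(0 <= n < N) cl2_term n s) (cos_psum t 1 N).
  rewrite /cos_psum.
  apply: (is_derive_sum_nat
    (df := fun n t => 1 ^+ n.+1 * cos (n.+1%:R * t) / n.+1%:R)).
  move=> n; have := is_derive_scale (n.+1%:R ^- 2) (is_derive_sin_mulr n.+1%:R t).
  under eq_fun do rewrite mulrC.
  move/is_derive_eq; apply; rewrite expr1n mul1r; field.
  by rewrite addrC natr1 pnatr_eq0.
have cC (t : R) : {for t, continuous (fun t => cos_psum t 1 N)}.
  suff H : is_derive t 1 (fun t => cos_psum t 1 N) (\sum_(0 <= n < N)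
      (1 ^+ n.+1 / n.+1%:R * (- sin (n.+1%:R * t) * n.+1%:R))).
    exact: is_derive_continuous H.
  apply: (is_derive_sum_nat (df := fun n t =>
    1 ^+ n.+1 / n.+1%:R * (- sin (n.+1%:R * t) * n.+1%:R))) => n.
  have := is_derive_scale (1 ^+ n.+1 / n.+1%:R)
    (@is_derive1_comp _ cos (fun s => n.+1%:R * s) t _ _
      (is_derive_cos (n.+1%:R * t)) (is_derive_mulr n.+1%:R t)).
  rewrite (_ : (fun _ => _) =
    fun s => 1 ^+ n.+1 * cos (n.+1%:R * s) / n.+1%:R)//.
  by apply/funext => s /=; rewrite mulrAC.
have Sint : \sum_(0 <= n < N) cl2_term n theta =
    - Rintegral mu `[theta, pi] (fun t => cos_psum t 1 N).
  rewrite /Rintegral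
    (integral_is_derive (F := fun t => \sum_(0 <= n < N) cl2_term n t))//=.
  rewrite [X in X - _]big1 ?sub0r ?opprK// => n _.
  by rewrite /cl2_term sin_natpi mul0r.
have iC : mu.-integrable `[theta, pi] (EFin \o (fun t => cos_psum t 1 N)).
  by apply: integrable_cont => t _.
have iL := integrable_cont cont_ln.
rewrite Sint -opprD normrN -RintegralD//.
apply: le_trans; first apply: le_normr_Rintegral => //.
  exact: integrableD iC iL.
pose c : R := 2 / (theta / 8) ^+ 2 / N.+1%:R.
apply: (@le_trans _ _ (Rintegral mu `[theta, pi] (cst c))).
  apply: le_Rintegral => //.
  - exact/integrable_norm/(integrableD _ iC iL).
  - by apply: integrable_cont => t _; exact: cvg_cst.
  - move=> t tp; apply: (le_trans (cos_psum_approx N (sin_half tp))).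
    have st := sin_half_ge th0 tp.
    rewrite /c -mulrA -invfM (mulrC N.+1%:R) ler_pM2l//.
    rewrite lef_pV2 ?posrE; last 2 first.
    + by rewrite mulr_gt0// exprn_gt0// sin_half.
    + by rewrite mulr_gt0// exprn_gt0// divr_gt0.
    rewrite ler_pM2r// lerXn2r ?nnegrE//; first by rewrite divr_ge0// ltW.
    by rewrite ltW// sin_half.
rewrite Rintegral_cst//= lebesgue_measure_itv/= lte_fin.
have c0 : 0 <= c by rewrite /c !mulr_ge0// invr_ge0 exprn_ge0// divr_ge0// ltW.
have -> : pi * (2 / (theta / 8) ^+ 2) / N.+1%:R = pi * c by rewrite -[LHS]mulrA.
case: ifP => _ /=; last by rewrite mulr0 mulr_ge0// pi_ge0.
by rewrite mulrC ler_wpM2r// gerBl ltW.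
Qed.

Lemma Cl2E : Cl2 theta = ln_sin_integral theta.
Proof.
apply/cvg_lim => //; apply/cvgrPdist_le => /= e e0.
set C := pi * (2 / (theta / 8) ^+ 2).
have C0 : 0 <= C.
  by rewrite !mulr_ge0 ?pi_ge0// invr_ge0 exprn_ge0// divr_ge0// ltW.
near=> N.
rewrite distrC; apply: (le_trans (clausen_psum_approx N)); rewrite -/C.
rewrite ler_pdivrMr// mulrC -ler_pdivrMr//.
apply: (@le_trans _ _ N%:R); last by rewrite ler_nat.
by near: N; exact: nbhs_infty_ger.
Unshelve. all: by end_near. Qed.

End fixed_angle.

Lemma Cl2_0 : Cl2 0 = 0 :> R.
Proof.
rewrite /Cl2 (_ : (fun n => _) = fun=> 0); last first.
  by apply/funext => n; rewrite mulr0 sin0 mul0r.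
apply/cvg_lim => //; rewrite (_ : series _ = fun=> 0); first exact: cvg_cst.
by apply/funext => n; rewrite /series /= big1.
Qed.

End clausen_integral.
(** * Evaluation of the mean *)

Section half_circle_evaluation.
Context {R : realType}.
Local Notation mu := (@lebesgue_measure R).

(* [|r + e^{i phi}|^2] for [r = 2 sin (t / 2)]; it is at least [1] exactly when
   [phi <= (pi + t) / 2] *)
Definition chord_sqr (t phi : R) : R :=
  (2 * sin (t / 2)) ^+ 2 + 2 * (2 * sin (t / 2)) * cos phi + 1.

(* the derivative in [t] of [ln |r + e^{i phi}|] *)
Definition chord_dlog (t phi : R) : R :=
  cos (t / 2) * (2 * sin (t / 2) + cos phi) / chord_sqr t phi.

(** The derivative in [t] of the positive part of [ln |r + e^{i phi}|]; the cut is where the modulus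
    crosses [1]. *)
Definition chord_kernel (t phi : R) : R :=
  if phi <= (pi + t) / 2 then chord_dlog t phi else 0.

Lemma cos_pihalfD (t : R) : cos ((pi + t) / 2) = - sin (t / 2).
Proof. by rewrite mulrDl addrC cosDpihalf. Qed.

Lemma sin_pihalfD (t : R) : sin ((pi + t) / 2) = cos (t / 2).
Proof. by rewrite mulrDl addrC sinDpihalf. Qed.

Lemma sin_half_ge0 (t : R) : 0 <= t <= pi -> 0 <= sin (t / 2).
Proof. by move=> tp; apply: sin_ge0_pi; lra. Qed.

Lemma le_cos_pihalfD (t phi : R) : 0 <= t <= pi -> 0 <= phi <= pi ->
  (phi <= (pi + t) / 2) = (- sin (t / 2) <= cos phi).
Proof.
move=> tp pp; rewrite -cos_pihalfD.
by rewrite leNgt [RHS]leNgt ltr_cos// in_itv/=; lra.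
Qed.

(** With [s = sin (t / 2)] one has [chord_sqr t phi - 1 = 4 s (s + cos phi)], and the threshold on
    [phi] is the sign of [s + cos phi]. *)
Lemma chord_sqr_ge1 (t phi : R) : 0 <= t <= pi -> 0 <= phi <= pi ->
  phi <= (pi + t) / 2 -> 1 <= chord_sqr t phi.
Proof.
move=> tp pp; rewrite le_cos_pihalfD// /chord_sqr => h.
by have := sin_half_ge0 tp; nra.
Qed.

Lemma chord_sqr_le1 (t phi : R) : 0 <= t <= pi -> 0 <= phi <= pi ->
  (pi + t) / 2 <= phi -> chord_sqr t phi <= 1.
Proof.
move=> tp pp; rewrite le_eqVlt => /predU1P[<-|].
  by rewrite /chord_sqr cos_pihalfD; nra.
rewrite ltNge le_cos_pihalfD// -ltNge /chord_sqr => h.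
by have := sin_half_ge0 tp; nra.
Qed.

Lemma measurable_chord_kernel :
  measurable_fun [set: R * R] (fun z => chord_kernel z.1 z.2).
Proof.
have mh : measurable_fun [set: R] (fun x : R => x / 2) by exact: measurable_funM.
have ms : measurable_fun [set: R * R] (fun z => sin (z.1 / 2)).
  exact: (measurableT_comp measurable_sin (measurableT_comp mh measurable_fst)).
have mc : measurable_fun [set: R * R] (fun z => cos (z.1 / 2)).
  exact: (measurableT_comp measurable_cos (measurableT_comp mh measurable_fst)).
have mp : measurable_fun [set: R * R] (fun z => cos z.2).
  exact: (measurableT_comp measurable_cos measurable_snd).
have m2s : measurable_fun [set: R * R] (fun z => 2 * sin (z.1 / 2)).
  exact: measurable_funM.
apply: measurable_fun_ifT => //.
  apply: measurable_fun_ler => //.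
  by apply: measurable_funM => //; exact: measurable_funD.
apply: measurable_funM.
  by apply: measurable_funM => //; exact: measurable_funD.
apply: (measurableT_comp measurable_inv); apply: measurable_funD => //.
apply: measurable_funD; first exact: measurable_funX.
by apply: measurable_funM => //; exact: measurable_funM.
Qed.

(** The cut keeps the denominator at least [1], and the numerator is at most [2 + 1]. *)
Lemma normr_chord_kernel (t phi : R) : 0 <= t <= pi -> 0 <= phi <= pi ->
  `|chord_kernel t phi| <= 3.
Proof.
move=> tp pp; rewrite /chord_kernel; case: ifP => h; last by rewrite normr0.
have D1 := chord_sqr_ge1 tp pp h; have D0 := lt_le_trans ltr01 D1.
rewrite /chord_dlog !normrM normfV (gtr0_norm D0) ler_pdivrMr//.
have c1 := cos_max (t / 2).
have s1 : `|2 * sin (t / 2) + cos phi| <= 3.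
  apply: (le_trans (ler_normD _ _)); rewrite normrM ger0_norm//.
  by have := sin_max (t / 2); have := cos_max phi; lra.
apply: (@le_trans _ _ 3); last by rewrite ler_peMr.
have := normr_ge0 (cos (t / 2)); have := normr_ge0 (2 * sin (t / 2) + cos phi).
by nra.
Qed.

Lemma integral_chord_kernel_phi (t : R) : 0 < t <= pi ->
  Rintegral mu `[0, pi] (chord_kernel t) = half_cot t.
Proof.
move=> tp; have p0 := @pi_gt0 R.
have tp' : 0 <= t <= pi by lra.
set s := sin (t / 2); set c := cos (t / 2).
have s0 : 0 < s by apply: sin_gt0_pi; lra.
set a := (pi + t) / 2.
have a0 : 0 <= a <= pi by rewrite /a; lra.
have in_a (x : R) : x \in `[0, a] -> 0 <= x <= pi /\ x <= a.
  by rewrite in_itv/= => /andP[x0 xa]; split => //; lra.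
have pos (x : R) : x \in `[0, a] -> 0 < 2 * s + cos x.
  move=> /in_a[xp]; rewrite le_cos_pihalfD// -/s; lra.
have Dpos (x : R) : x \in `[0, a] -> 0 < chord_sqr t x.
  by move=> /in_a[xp xa]; apply: lt_le_trans (chord_sqr_ge1 tp' xp xa).
have -> : Rintegral mu `[0, pi] (chord_kernel t) =
    Rintegral mu `[0, a] (chord_dlog t).
  rewrite /Rintegral; congr fine; rewrite integral_mkcond [RHS]integral_mkcond.
  apply: eq_integral => x _; rewrite /patch !mem_setE !in_itv/= /chord_kernel -/a.
  case: (leP 0 x) => //= x0; have [xa|xa] := leP x a; last by case: ifP.
  by rewrite (le_trans xa)//; lra.
(* The arc tangent is the argument of [r + e^{ix}], whose real part is positive on [[0, a]]. At [a]
   the argument is [pi/2 - t/2], so the bracket equals [t] there, and it is [0] at [0]. *)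
pose F (x : R) := c / (2 * s) * (x - atan (sin x / (2 * s + cos x))).
rewrite /Rintegral (integral_is_derive (F := F)); first last.
- move=> x xa; apply: continuousM; last first.
    apply: continuousV; first by rewrite gt_eqF// Dpos.
    apply: continuousD; last exact: cvg_cst.
    apply: continuousD; first exact: cvg_cst.
    by apply: continuousM; [exact: cvg_cst|exact: continuous_cos].
  apply: continuousM; first exact: cvg_cst.
  by apply: continuousD; [exact: cvg_cst|exact: continuous_cos].
- move=> x xa; have x0 := pos _ xa; have D0 := Dpos _ xa.
  have xn0 : 2 * s + cos x != 0 by rewrite gt_eqF.
  have d1 : is_derive x 1 (fun x => 2 * s + cos x) (- sin x).
    have := is_deriveD (is_derive_cst (2 * s) x (1:R)) (is_derive_cos x).
    by rewrite add0r.
  have d2 := is_deriveM (is_derive_sin x)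
    (@is_deriveV _ (fun x => 2 * s + cos x) _ _ _ xn0 d1).
  have d3 := @is_derive1_comp _ (@atan R) (fun x => sin x / (2 * s + cos x)) x _ _
    (is_derive1_atan _) d2.
  have := is_derive_scale (c / (2 * s)) (is_deriveB (is_derive_id x (1:R)) d3).
  move/is_derive_eq; apply; rewrite /GRing.scale/= /chord_dlog -/s -/c.
  have E : chord_sqr t x = (2 * s + cos x) ^+ 2 + sin x ^+ 2.
    by rewrite /chord_sqr -/s sin2cos2; ring.
  move: (gt_eqF D0); rewrite E; set D := _ + _ => Dn0.
  have -> : 1 + (sin x / (2 * s + cos x)) ^+ 2 = D / (2 * s + cos x) ^+ 2.
    by rewrite /D; field.
  (* Indeed [D - sin x ^+ 2 - (2 s + cos x) cos x = 2 s (2 s + cos x)]. *)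
  have -> : c * (2 * s + cos x) / D =
      c / (2 * s) * ((D - sin x ^+ 2 - (2 * s + cos x) * cos x) / D).
    by rewrite /D; field; rewrite -/D Dn0 gt_eqF.
  congr (_ * _).
  by field; rewrite Dn0 xn0.
- lra.
rewrite /= /F sin0 mul0r atan0 subr0 mulr0 subr0.
rewrite sin_pihalfD cos_pihalfD -/s -/c.
have -> : 2 * s + - s = s by lra.
have -> : atan (c / s) = pi / 2 - t / 2.
  have -> : c / s = tan (pi / 2 - t / 2).
    by rewrite /tan sinB cosB sin_pihalf cos_pihalf !mul1r !mul0r subr0 add0r.
  by rewrite tanK// in_itv/=; lra.
rewrite /half_cot -/s -/c /a; by field; rewrite gt_eqF.
Qed.

Lemma integral_chord_kernel_t (theta phi : R) :
  0 < theta <= pi -> 0 <= phi <= pi ->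
  Rintegral mu `[theta, pi] (chord_kernel^~ phi) =
  lnp_circle 2 (cos phi) - lnp_circle (2 * sin (theta / 2)) (cos phi).
Proof.
move=> thp pp.
have lnpE (t : R) : lnp_circle (2 * sin (t / 2)) (cos phi) =
    Num.max 0 (ln (chord_sqr t phi) / 2) by [].
have -> : lnp_circle 2 (cos phi) = lnp_circle (2 * sin (pi / 2)) (cos phi).
  by rewrite sin_pihalf mulr1.
rewrite !lnpE.
(* As a function of [t] the kernel vanishes below [2 phi - pi], so integration effectively starts at
   [m]. *)
pose m := Num.max theta (2 * phi - pi).
have mth : theta <= m by rewrite le_max lexx.
have mpi : m <= pi by rewrite ge_max; lra.
have mphi : 2 * phi - pi <= m by rewrite le_max lexx orbT.
have Dge (t : R) : t \in `[m, pi] -> 1 <= chord_sqr t phi.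
  by rewrite in_itv/= => /andP[mt tp]; apply: chord_sqr_ge1 => //; lra.
have -> : Rintegral mu `[theta, pi] (chord_kernel^~ phi) =
    Rintegral mu `[m, pi] (chord_dlog^~ phi).
  rewrite /Rintegral; congr fine; rewrite integral_mkcond [RHS]integral_mkcond.
  apply: eq_integral => t _; rewrite /patch !mem_setE !in_itv/= /chord_kernel.
  have -> : (phi <= (pi + t) / 2) = (2 * phi - pi <= t) by apply/idP/idP; lra.
  rewrite /m ge_max.
  by case: (theta <= t); case: (t <= pi); case: (2 * phi - pi <= t).
rewrite /Rintegral
  (integral_is_derive (F := fun t => ln (chord_sqr t phi) / 2))//=.
- rewrite [X in _ = X - _]max_r; last first.
    by rewrite divr_ge0// ln_ge0// Dge// in_itv/= mpi lexx.
  (* If [theta <= 2 phi - pi], the modulus is at most [1] at [theta] and exactly [1] at [m], so both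
     lower terms are [0]. Otherwise [m = theta] and the logarithm at [theta] is already
     nonnegative. *)
  congr (_ - _); rewrite /m; case: (leP theta (2 * phi - pi)) => h.
    have hp : (pi + theta) / 2 <= phi by lra.
    have := @chord_sqr_le1 theta phi ltac:(lra) pp hp => D1.
    rewrite max_l; last by have := ln_le0 D1; lra.
    have -> : chord_sqr (2 * phi - pi) phi = 1.
      rewrite /chord_sqr.
      have -> : (2 * phi - pi) / 2 = phi - pi / 2 by lra.
      by rewrite sinBpihalf; ring.
    by rewrite ln1 mul0r.
  rewrite max_r// divr_ge0// ln_ge0// chord_sqr_ge1//; lra.
- move=> t tm; have D1 := Dge _ tm; have D0 := lt_le_trans ltr01 D1.
  have d1 := is_derive_scale 2 (is_derive_sin_half t).
  have d2 : is_derive t 1 (chord_sqr^~ phi)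
      (2 * cos (t / 2) * (2 * sin (t / 2) + cos phi)).
    have := is_deriveD (is_deriveD (is_deriveM d1 d1)
      (is_derive_scale (2 * cos phi) d1)) (is_derive_cst (1:R) t (1:R)).
    rewrite (_ : _ + _ = chord_sqr^~ phi); last first.
      apply/funext => x; rewrite /chord_sqr.
      rewrite -[LHS]/(2 * sin (x / 2) * (2 * sin (x / 2)) +
         2 * cos phi * (2 * sin (x / 2)) + 1); ring.
    by move/is_derive_eq; apply; rewrite /GRing.scale/=; field.
  have := is_derive_scale 2^-1 (@is_derive1_comp _ (@ln R) (chord_sqr^~ phi) t _ _
    (is_derive1_ln D0) d2).
  rewrite (_ : (fun s => 2^-1 * _) = fun t => ln (chord_sqr t phi) / 2); last first.
    by apply/funext => x; rewrite [RHS]mulrC.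
  by move/is_derive_eq; apply; rewrite /chord_dlog; field; rewrite gt_eqF.
- move=> t tm; have D1 := Dge _ tm; have D0 := lt_le_trans ltr01 D1.
  have cs : {for t, continuous (fun t : R => sin (t / 2))}.
    exact: is_derive_continuous (is_derive_sin_half t).
  have c2s : {for t, continuous (fun t : R => 2 * sin (t / 2))}.
    by apply: continuousM => //; exact: cvg_cst.
  apply: continuousM; last first.
    apply: continuousV; first by rewrite gt_eqF.
    apply: continuousD; last exact: cvg_cst.
    apply: continuousD; first exact: continuousM.
    apply: continuousM; last exact: cvg_cst.
    by apply: continuousM => //; exact: cvg_cst.
  apply: continuousM; first exact: is_derive_continuous (is_derive_cos_half t).
  by apply: continuousD => //; exact: cvg_cst.
Qed.

Lemma lebesgue_measure_segment_lty (a b : R) : (mu `[a, b]%classic < +oo)%E.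
Proof.
rewrite lebesgue_measure_itv/= lte_fin.
by case: ifP => _; rewrite ?ltry// -EFinB ltry.
Qed.

Lemma integrable_lnp_circle_cos (r : R) :
  mu.-integrable `[0, pi] (EFin \o (fun phi => lnp_circle r (cos phi))).
Proof.
apply: measurable_bounded_integrable => //.
- exact: lebesgue_measure_segment_lty.
- apply: (@measurable_funS _ _ _ _ setT) => //.
  by apply: measurable_lnp_circle => //; exact: measurable_cos.
exists ((`|r| + 1) ^+ 2); split; first exact: num_real.
move=> y My phi _ /=; apply: le_trans (ltW My).
rewrite ger0_norm ?lnp_circle_ge0// ge_max sqr_ge0/= /ln_circle.
have wle : r ^+ 2 + 2 * r * cos phi + 1 <= (`|r| + 1) ^+ 2.
  have : r * cos phi <= `|r|.
    by rewrite (le_trans (ler_norm _))// normrM ler_piMr// cos_max.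
  by rewrite sqrrD real_normK ?num_real//; lra.
have [w0|w0] := leP (r ^+ 2 + 2 * r * cos phi + 1) 0.
  by rewrite ln0// mul0r sqr_ge0.
by have := ln_sublinear w0; lra.
Qed.

(** Differentiation under the integral sign is avoided by integrating [chord_kernel] over
    [[theta, pi] x [0, pi]] in both orders: [phi] first gives the integral of [half_cot], [t] first
    gives the increment of [half_circle_lnp] from [theta] to [pi]. *)
Lemma half_circle_lnpE (theta : R) : 0 <= theta <= pi ->
  half_circle_lnp (2 * sin (theta / 2)) =
  theta * ln (2 * sin (theta / 2)) + Cl2 theta.
Proof.
move=> /andP[]; rewrite le_eqVlt => /predU1P[<- _|th0 thpi].
  (* At [theta = 0] both sides are [0], the factor [theta] killing the logarithm. *)
  by rewrite mul0r sin0 mulr0 half_circle_lnp0 mul0r Cl2_0 addr0.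
rewrite Cl2E// ln_sin_integralE// -half_circle_lnp2.
suff -> : Rintegral mu `[theta, pi] half_cot =
    half_circle_lnp 2 - half_circle_lnp (2 * sin (theta / 2)) by lra.
transitivity (Rintegral mu `[theta, pi]
  (fun t => Rintegral mu `[0, pi] (chord_kernel t))).
  apply: eq_Rintegral => t; rewrite inE/= in_itv/= => /andP[tht tp].
  by rewrite integral_chord_kernel_phi// tp (lt_le_trans th0).
rewrite (@Rintegral_Fubini_bounded _ _ _ chord_kernel 3)//.
- rewrite /half_circle_lnp -RintegralB//; try exact: integrable_lnp_circle_cos.
  apply: eq_Rintegral => phi; rewrite inE/= in_itv/= => pp.
  by rewrite integral_chord_kernel_t// th0.
- exact: lebesgue_measure_segment_lty.
- exact: lebesgue_measure_segment_lty.
- exact: measurable_chord_kernel.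
- move=> t phi /=; rewrite !in_itv/= => /andP[tht tp] pp.
  by apply: normr_chord_kernel => //; rewrite tp (le_trans (ltW th0)).
Qed.

End half_circle_evaluation.

Unset Implicit Arguments.

Theorem theorem3p3 (R : realType) (k : nat) (hk : (0 < k)%N) :
  multi_mahler (2 * k).+1 [seq @P1xyz R k j | j <- iota 1 k] =
  (pi ^+ k.+1)^-1 *
    Rintegral lebesgue_measure `[0, pi]
      (fun theta : R => (theta * ln (2 * sin (theta / 2)) + Cl2 theta) ^+ k).
Proof.
rewrite multi_mahler_1xyz Rintegral_mahler_1xyz_pow; congr (_ * _).
apply: eq_Rintegral => theta; rewrite inE/= in_itv/= => thp.
by rewrite half_circle_lnpE.
Qed.
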